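(* Let $K$ and $L$ be convex bodies in the plane $\mathbb{R}^2$ such that $L$ is (centrally) symmetric. If the Banach-Mazur distance satisfies $d(K, L)=2$, then $K$ is a triangle.
   Context: A set $K \subset \mathbb{R}^n$ is a convex body if it is compact, convex and has non-empty interior. A convex body is (centrally) symmetric if it has a center of symmetry (not necessarily the origin). The Banach-Mazur distance between convex bodies $K, L \subset \mathbb{R}^n$ is $$d(K, L) = \inf \{r>0 : K + u \subset T(L+v) \subset r(K+u)\},$$ where the infimum is taken over all invertible linear operators $T: \mathbb{R}^n \to \mathbb{R}^n$ and all $u, v \in \mathbb{R}^n$ for which the inclusions hold. A triangle means the convex hull of three affinely independent points. *)

(* Defs.v *)
From HB Require Import structures.
From mathcomp Require Import all_boot all_order all_algebra.
From mathcomp Require Import all_classical all_reals all_analysis.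

Set Implicit Arguments.
Unset Strict Implicit.
Unset Printing Implicit Defensive.

Import Order.TTheory GRing.Theory Num.Theory.
Import numFieldNormedType.Exports.

Local Open Scope classical_set_scope.
Local Open Scope ring_scope.

Definition convex_body (R : realType) (n : nat) (K : set 'rV[R]_n) : Prop :=
  [/\ compact K, convex_set K & interior K !=set0].

(* [c] is the center of symmetry; it need not be the origin. *)
Definition centrally_symmetric (R : realType) (n : nat) (K : set 'rV[R]_n) :
  Prop :=
  exists c : 'rV[R]_n, forall x, K x -> K (c *+ 2 - x).

Definition translate (R : realType) (n : nat) (K : set 'rV[R]_n)
  (u : 'rV[R]_n) : set 'rV[R]_n := [set x + u | x in K].

Definition dilate (R : realType) (n : nat) (r : R) (K : set 'rV[R]_n) :
  set 'rV[R]_n := [set r *: x | x in K].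

(* [inf] is the infimum of a set of reals, equal to 0 on the empty set; for
   convex bodies the set below is nonempty and bounded below, so this is the
   genuine infimum. *)
Definition banach_mazur (R : realType) (n : nat) (K L : set 'rV[R]_n) : R :=
  inf [set r : R | 0 < r /\
    exists (T : {linear 'rV[R]_n -> 'rV[R]_n}) (u v : 'rV[R]_n),
      [/\ bijective T,
          translate K u `<=` T @` translate L v &
          T @` translate L v `<=` dilate r (translate K u)]].

Definition convex_hull (R : realType) (n : nat) (A : set 'rV[R]_n) :
  set 'rV[R]_n := smallest (@convex_set R 'rV[R]_n) A.

Definition is_triangle (R : realType) (n : nat) (K : set 'rV[R]_n) : Prop :=
  exists a b c : 'rV[R]_n,
    free [:: b - a; c - a] /\ K = convex_hull [set a; b; c].

(* Main.v *)
(* Translate L so that its centre is 0, and replace it by an affine copy of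
   maximal area inside K.  Every affine map psi from L to K then satisfies
   tr psi <= 2 and det psi <= 1, as one sees from (1 - t) id + t psi.

   By separation, distance 2 means that for every copy A L of L in K there are
   z_j in K, f_j in the polar of L and weights w_j of sum 1 such that
   sum w_j f_j = 0 and B = sum w_j (f_j (x) z_j) satisfies tr (A^-1 B) >= 2.
   Each such B is the linear part of x |-> sum w_j (1 + f_j x) z_j, which maps
   L to K.  Maximise det B among those with tr B = 2: the copies
   (1 - t) I + t B with t small show that det B = 1, so that B L is again of
   maximal area.  Taking B L for L gives I = sum w_j (f_j (x) z_j).

   John's theorem provides contact points x_i, common support functionals y_i
   and weights c_i with I / 2 = sum c_i (y_i (x) x_i) and sum c_i y_i = 0.
   Comparing both decompositions gives (1 - y_i z_j) (1 + f_j x_i) = 0, whence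
   every line y_i = 1 carries at least half of the mass w of the z_j.  When the
   number of lines is minimal every z_j lies on at most two of them, so there
   are three or four lines.  Three lines bound a triangle whose vertices are
   among the z_j, so the triangle is K.  Four lines make L the Varignon
   parallelogram of a quadrilateral contained in K, and moving its corners
   along the sides increases the area. *)

Require Import Defs.
From mathcomp Require Import all_boot all_order all_algebra.
From mathcomp Require Import all_classical all_reals all_analysis.
From mathcomp Require Import ring lra.

Set Implicit Arguments.
Unset Strict Implicit.
Unset Printing Implicit Defensive.

Import Order.TTheory GRing.Theory Num.Theory.
Import numFieldNormedType.Exports.

Local Open Scope classical_set_scope.
Local Open Scope ring_scope.

(** * Convex hulls of compact sets *)

Definition dot (R : realType) n (u v : 'rV[R]_n) : R :=
  \sum_i u 0 i * v 0 i.

(** Finite combinations of any length: weights and points can be extracted from membership, which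
    the smallest-set form [convex_hull] does not offer directly. *)
Definition hull (R : realType) n (S : set 'rV[R]_n) : set 'rV[R]_n :=
  [set v | exists m (b : 'I_m -> R) (p : 'I_m -> 'rV[R]_n),
    [/\ forall i, 0 <= b i, \sum_i b i = 1, forall i, S (p i)
      & v = \sum_i b i *: p i]].

Section Hull.
Variables (R : realType) (n : nat).
Implicit Types (S : set 'rV[R]_n) (u v w : 'rV[R]_n).

Lemma dotC u v : dot u v = dot v u.
Proof. by apply: eq_bigr => i _; rewrite mulrC. Qed.

Lemma dotDr u v w : dot u (v + w) = dot u v + dot u w.
Proof. by rewrite -big_split; apply: eq_bigr => i _; rewrite mxE mulrDr. Qed.

Lemma dotZr a u v : dot u (a *: v) = a * dot u v.
Proof. by rewrite mulr_sumr; apply: eq_bigr => i _; rewrite mxE mulrCA. Qed.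

Lemma dotNr u v : dot u (- v) = - dot u v.
Proof. by rewrite -scaleN1r dotZr mulN1r. Qed.

Lemma dotBr u v w : dot u (v - w) = dot u v - dot u w.
Proof. by rewrite dotDr dotNr. Qed.

Lemma dot0r u : dot u 0 = 0.
Proof. by rewrite -(subrr u) dotBr subrr. Qed.

Lemma dot_sumr m u (b : 'I_m -> R) (p : 'I_m -> 'rV[R]_n) :
  dot u (\sum_i b i *: p i) = \sum_i b i * dot u (p i).
Proof.
elim: m b p => [|m ih] b p; first by rewrite !big_ord0 dot0r.
by rewrite !big_ord_recl dotDr ih dotZr.
Qed.

Lemma dotvv_ge0 u : 0 <= dot u u.
Proof. by apply: sumr_ge0 => i _; rewrite -expr2 sqr_ge0. Qed.

Lemma dotvv_eq0 u : dot u u = 0 -> u = 0.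
Proof.
move=> /eqP; rewrite psumr_eq0 => [/allP h|i _]; last by rewrite -expr2 sqr_ge0.
apply/rowP => i; have := h i (mem_index_enum _).
by rewrite /= -expr2 sqrf_eq0 => /eqP ->; rewrite mxE.
Qed.

Lemma sub_hull S : S `<=` hull S.
Proof.
move=> v Sv; exists 1%N, (fun=> 1), (fun=> v).
by split=> //; rewrite big_ord1 ?scale1r.
Qed.

Lemma hull_convex S u v (t : R) :
  0 <= t <= 1 -> hull S u -> hull S v -> hull S ((1 - t) *: u + t *: v).
Proof.
move=> /andP[t0 t1] [m [b [p [b0 b1 Sp ->]]]] [m' [c [q [c0 c1 Sq ->]]]].
exists (m + m')%N.
exists (fun i => match fintype.split i with inl j => (1 - t) * b j | inr j => t * c j end).
exists (fun i => match fintype.split i with inl j => p j | inr j => q j end).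
split.
- move=> i; case: (fintype.split i) => j; first by rewrite mulr_ge0// subr_ge0.
  exact: mulr_ge0.
- rewrite big_split_ord/=; under eq_bigr do rewrite (unsplitK (inl _)).
  under [X in _ + X]eq_bigr do rewrite (unsplitK (inr _)).
  by rewrite -!mulr_sumr b1 c1 !mulr1 subrK.
- by move=> i; case: (fintype.split i).
- rewrite big_split_ord/=; under [in RHS]eq_bigr do rewrite (unsplitK (inl _)).
  under [X in _ = _ + X]eq_bigr do rewrite (unsplitK (inr _)).
  by rewrite !scaler_sumr; congr (_ + _); apply: eq_bigr => i _; rewrite scalerA.
Qed.

(** More than n + 1 points are affinely dependent: the matrix with rows (p_i, 1) has a nonzero left
    kernel vector k. Moving the weights along k until the first one vanishes removes a point. *)
Lemma caratheodory_step S v m (b : 'I_m.+1 -> R) (p : 'I_m.+1 -> 'rV[R]_n) :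
  (n < m)%N -> (forall i, 0 <= b i) -> \sum_i b i = 1 -> (forall i, S (p i)) ->
  v = \sum_i b i *: p i ->
  exists (b' : 'I_m -> R) (p' : 'I_m -> 'rV[R]_n),
    [/\ forall i, 0 <= b' i, \sum_i b' i = 1, forall i, S (p' i)
      & v = \sum_i b' i *: p' i].
Proof.
move=> nm b0 b1 Sp ->.
pose P : 'M[R]_(m.+1, n + 1) := \matrix_i row_mx (p i) 1.
have [k [k0 kP]] : exists k : 'rV[R]_m.+1, k != 0 /\ k *m P = 0.
  have : kermx P != 0.
    rewrite kermx_eq0 /row_free neq_ltn; apply/orP; left.
    by rewrite (leq_ltn_trans (rank_leq_col _))// addn1 ltnS.
  move=> /rowV0Pn[k kk k0]; exists k; split=> //.
  exact/sub_kermxP.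
have kp : \sum_i k 0 i *: p i = 0.
  apply/rowP => i; transitivity ((k *m P) 0 (lshift 1 i)); last first.
    by rewrite kP !mxE.
  rewrite summxE [RHS]mxE; apply: eq_bigr => j _.
  by rewrite [LHS]mxE [in RHS]mxE row_mxEl.
have ks : \sum_i k 0 i = 0.
  transitivity ((k *m P) 0 (rshift n 0)); last by rewrite kP mxE.
  rewrite [RHS]mxE; apply: eq_bigr => j _.
  by rewrite [in RHS]mxE row_mxEr mxE mulr1.
have [j0 kj0] : exists j, 0 < k 0 j.
  apply: contrapT => /forallNP kle.
  have kle0 i : k 0 i <= 0 by rewrite leNgt; apply/negP/kle.
  move: k0 => /eqP; apply; apply/rowP => i; rewrite mxE.
  have /eqP : \sum_i - k 0 i = 0 by rewrite sumrN ks oppr0.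
  rewrite psumr_eq0 => [/allP/(_ i (mem_index_enum _))/=|j _].
    by rewrite oppr_eq0 => /eqP.
  by rewrite oppr_ge0.
(* The least ratio b_i / k_i over k_i > 0 is the largest t for which b - t k stays nonnegative; the
   weight at the minimising index becomes 0. *)
pose j := [arg min_(i < j0 | 0 < k 0 i) (b i / k 0 i)]%O.
have [kj jmin] : 0 < k 0 j /\ forall i, 0 < k 0 i -> b j / k 0 j <= b i / k 0 i.
  by rewrite /j; case: arg_minP => // i ki h; split=> // i' /h.
set t := b j / k 0 j in jmin.
have t0 : 0 <= t by rewrite divr_ge0// ltW.
pose c i := b i - t * k 0 i.
have cj : c j = 0 by rewrite /c /t divfK ?subrr// gt_eqF.
exists (fun i => c (lift j i)), (fun i => p (lift j i)); split=> //.
- move=> i; rewrite /c subr_ge0; case: (ltP 0 (k 0 (lift j i))) => [ki|ki].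
    by rewrite -ler_pdivlMr// jmin.
  by rewrite (le_trans _ (b0 _))// mulr_ge0_le0.
- have : \sum_i c i = 1 by rewrite sumrB b1 -mulr_sumr ks mulr0 subr0.
  by rewrite (bigD1_ord j)//= cj add0r.
- have -> : \sum_i b i *: p i = \sum_i c i *: p i.
    under [RHS]eq_bigr do rewrite scalerBl -scalerA.
    by rewrite sumrB -scaler_sumr kp scaler0 subr0.
  by rewrite (bigD1_ord j)//= cj scale0r add0r.
Qed.

(** The length n + 1 is the same for every point, as the compactness of the hull requires; shorter
    combinations are padded by zero weights on a repeated point. *)
Lemma caratheodory S v : hull S v ->
  exists (b : 'I_n.+1 -> R) (p : 'I_n.+1 -> 'rV[R]_n),
    [/\ forall i, 0 <= b i, \sum_i b i = 1, forall i, S (p i)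
      & v = \sum_i b i *: p i].
Proof.
move=> [m [b [p [b0 b1 Sp vE]]]].
have m0 : (0 < m)%N.
  case: m b p b0 b1 {Sp vE} => // b p _; rewrite big_ord0 => /eqP.
  by rewrite eq_sym oner_eq0.
have pad m1 (b' : 'I_m1 -> R) (p' : 'I_m1 -> 'rV[R]_n) d :
    (0 < m1)%N -> (m1 + d = n.+1)%N ->
    [/\ forall i, 0 <= b' i, \sum_i b' i = 1, forall i, S (p' i)
      & v = \sum_i b' i *: p' i] ->
    exists (b : 'I_n.+1 -> R) (p : 'I_n.+1 -> 'rV[R]_n),
    [/\ forall i, 0 <= b i, \sum_i b i = 1, forall i, S (p i)
      & v = \sum_i b i *: p i].
  move=> m10 <- [b'0 b'1 Sp' v'E].
  exists (fun i => match fintype.split i with inl j => b' j | inr j => 0 end).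
  exists (fun i => match fintype.split i with inl j => p' j
    | inr j => p' (Ordinal m10) end); split.
  + by move=> i; case: (fintype.split i).
  + rewrite big_split_ord/=; under eq_bigr do rewrite (unsplitK (inl _)).
    under [X in _ + X]eq_bigr do rewrite (unsplitK (inr _)).
    by rewrite b'1 big1// addr0.
  + by move=> i; case: (fintype.split i).
  + rewrite big_split_ord/=; under [in RHS]eq_bigr do rewrite (unsplitK (inl _)).
    under [X in _ = _ + X]eq_bigr do rewrite (unsplitK (inr _)) scale0r.
    by rewrite big1_eq addr0.
elim/ltn_ind : m => m ih in b p b0 b1 Sp vE m0 *.
case: (leqP m n.+1) => mn.
  apply: (pad m b p (n.+1 - m)%N) => //; exact: subnKC.
case: m ih b p b0 b1 Sp vE m0 mn => // m ih b p b0 b1 Sp vE _ mn.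
have [b' [p' [h1 h2 h3 h4]]] := caratheodory_step mn b0 b1 Sp vE.
apply: (ih m (ltnSn m) b' p' h1 h2 h3 h4).
exact: (leq_ltn_trans (leq0n n) mn).
Qed.

End Hull.

(** * Coordinatewise continuity *)

Lemma rV_coord_continuous (T : topologicalType) n (i : 'I_n) :
  continuous (fun v : 'rV[T]_n => v 0 i).
Proof.
move=> v B vB; exists (fun _ j => if j == i then B else setT).
  move=> i' j; rewrite (ord1 i'); case: eqP => [->|_] //; exact: filterT.
by move=> N /(_ 0 i); rewrite eqxx.
Qed.

Lemma mx_continuous (T U : topologicalType) m n (g : T -> 'M[U]_(m, n)) :
  (forall i j, continuous (fun x => g x i j)) -> continuous g.
Proof.
move=> cg x A [P nP sPA].
have : \forall y \near x, forall i j, P i j (g y i j).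
  apply: filter_forall => i; apply: filter_forall => j.
  exact: (cg i j x _ (nP i j)).
by apply: filterS => y h; apply: sPA.
Qed.

Lemma rV_continuous (T U : topologicalType) n (g : T -> 'rV[U]_n) :
  (forall i, continuous (fun x => g x 0 i)) -> continuous g.
Proof. by move=> cg; apply: mx_continuous => i j; rewrite (ord1 i); exact: cg. Qed.

Section ContinuousFunctions.
Variables (T : topologicalType) (R : realType).
Implicit Types f g : T -> R.

Lemma cont_cst (a : R) : continuous (fun _ : T => a).
Proof. exact: cst_continuous. Qed.

Lemma contD f g : continuous f -> continuous g -> continuous (fun x => f x + g x).
Proof. by move=> cf cg x; apply: continuousD; [exact: cf|exact: cg]. Qed.

Lemma contN f : continuous f -> continuous (fun x => - f x).
Proof. by move=> cf x; apply: continuousN; exact: cf. Qed.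

Lemma contM f g : continuous f -> continuous g -> continuous (fun x => f x * g x).
Proof. by move=> cf cg x; apply: continuousM; [exact: cf|exact: cg]. Qed.

End ContinuousFunctions.

Lemma sum_continuous (T : topologicalType) (R : realType) m (f : 'I_m -> T -> R) :
  (forall i, continuous (f i)) -> continuous (fun x => \sum_i f i x).
Proof.
elim: m f => [|m ih] f cf.
  rewrite (_ : (fun _ => _) = cst 0); first exact: cst_continuous.
  by apply/funext => x; rewrite big_ord0.
rewrite (_ : (fun _ => _) =
    fun x => f ord0 x + \sum_(i < m) f (lift ord0 i) x); last first.
  by apply/funext => x; rewrite big_ord_recl.
apply: contD; first exact: cf.
by apply: ih => i; exact: cf.
Qed.

Section HullCompact.
Variables (R : realType) (n : nat).
Implicit Types (S : set 'rV[R]_n) (u v w : 'rV[R]_n).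

Lemma dot_continuous u : continuous (dot u).
Proof.
apply: sum_continuous => i; apply: contM; first exact: cont_cst.
exact: rV_coord_continuous.
Qed.

Lemma dotvv_continuous : continuous (fun v : 'rV[R]_n => dot v v).
Proof.
by apply: sum_continuous => i; apply: contM; exact: rV_coord_continuous.
Qed.

(** By [caratheodory] the hull is the continuous image of a closed part of the product of a cube
    with a power of S. *)
Lemma hull_compact S : compact S -> compact (hull S).
Proof.
move=> cS; pose W := 'rV[R]_n.+1; pose P := 'rV['rV[R]_n]_n.+1.
pose A : set (W * P) := [set w : W | forall i, `[0, 1]%classic (w 0 i)] `*`
  [set p : P | forall i, S (p 0 i)].
have cA : compact A.
  apply: compact_setX; last exact: (@rV_compact 'rV[R]_n _ (fun=> S)).
  apply: (@rV_compact R _ (fun=> `[0, 1]%classic)) => i.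
  exact: segment_compact.
have fst_cont i : continuous (fun x : W * P => x.1 0 i : R).
  move=> x; apply: (@cvg_comp _ _ _ fst (fun w : W => w 0 i)).
    exact: cvg_fst.
  exact: rV_coord_continuous.
have snd_cont i : continuous (fun x : W * P => x.2 0 i : 'rV[R]_n).
  move=> x; apply: (@cvg_comp _ _ _ snd (fun p : P => p 0 i)).
    exact: cvg_snd.
  exact: rV_coord_continuous.
pose g (x : W * P) := \sum_i x.1 0 i.
have cg : continuous g by apply: sum_continuous => i; exact: fst_cont.
pose h (x : W * P) := \sum_i x.1 0 i *: x.2 0 i.
have ch : continuous h.
  apply: rV_continuous => j.
  have -> : (fun x => h x 0 j) = fun x : W * P => \sum_i x.1 0 i * x.2 0 i 0 j.
    by apply/funext => x; rewrite /h summxE; apply: eq_bigr => i _; rewrite mxE.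
  apply: sum_continuous => i; apply: contM; first exact: fst_cont.
  move=> x; apply: (@cvg_comp _ _ _ (fun x : W * P => x.2 0 i) (fun v => v 0 j)).
    exact: snd_cont.
  exact: rV_coord_continuous.
rewrite (_ : hull S = h @` (A `&` g @^-1` [set 1])).
  apply: continuous_compact; first exact: continuous_subspaceT.
  apply: compact_closedI => //.
  by apply: preimage_closed; [move=> x _; exact: cg|exact: closed_eq].
apply/seteqP; split=> [v /caratheodory[b [p [b0 b1 Sp ->]]]|_ [x [Ax gx] <-]].
  exists (\row_i b i, \row_i p i); last first.
    by apply: eq_bigr => i _; rewrite !mxE.
  split; last by rewrite /g /=; rewrite -[RHS]b1; apply: eq_bigr => i _; rewrite mxE.
  split=> i /=; rewrite mxE//= in_itv/= b0/= -b1.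
  by rewrite (bigD1 i)//= lerDl sumr_ge0.
exists n.+1, (fun i => x.1 0 i), (fun i => x.2 0 i); split=> //.
- by move=> i; have := Ax.1 i; rewrite /= in_itv/= => /andP[].
- by move=> i; exact: Ax.2 i.
Qed.

(** The vector w is the point v of the hull nearest to 0: if v.p <= 0 for some p in S, a short move
    from v towards p would decrease the norm. For an empty hull any w works. *)
Lemma hull_separation S : compact S ->
  hull S 0 \/ exists w, forall p, S p -> 0 < dot w p.
Proof.
move=> cS; have [h0|h0] := pselect (hull S 0); [by left|right].
have [S0|/set0P S0] := eqVneq (hull S) set0.
  by exists 0 => p /sub_hull; rewrite S0.
have [v] := compact_EVT_min S0 (hull_compact cS)
  (continuous_subspaceT dotvv_continuous).
rewrite inE => hv vmin; exists v => p Sp.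
have vv : 0 < dot v v.
  rewrite lt_neqAle dotvv_ge0 andbT eq_sym; apply/eqP => /dotvv_eq0 v0.
  by apply: h0; rewrite -v0.
have key t : 0 <= t <= 1 ->
    0 <= t * (2 * (dot v p - dot v v) + t * dot (p - v) (p - v)).
  move=> t01; have := vmin ((1 - t) *: v + t *: p).
  rewrite inE => /(_ (hull_convex t01 hv (sub_hull Sp))).
  have -> : (1 - t) *: v + t *: p = v + t *: (p - v).
    by rewrite scalerBr scalerBl scale1r addrAC addrA.
  rewrite -dotBr; move: (p - v) => q.
  rewrite dotDr dotZr ![dot (v + _) _]dotC !dotDr !dotZr [dot q v]dotC.
  by lra.
have [pv0|pv0] := leP (dot (p - v) (p - v)) 0.
  have := key 1; rewrite ler01 lexx mul1r mul1r => /(_ isT).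
  by lra.
rewrite ltNge; apply/negP => vp.
set d := dot (p - v) (p - v) in key pv0 *.
(* With this t one has t |p - v|^2 <= |v|^2, which is outweighed in [key] by 2 (v.p - |v|^2) <= -2
   |v|^2. *)
pose t := Order.min 1 (dot v v / d).
have t0 : 0 < t by rewrite lt_min ltr01 divr_gt0.
have t1 : t <= 1 by rewrite ge_min lexx.
have td : t * d <= dot v v by rewrite -ler_pdivlMr// ge_min lexx orbT.
have := key t; rewrite (ltW t0) t1 pmulr_rge0// => /(_ isT).
by lra.
Qed.

End HullCompact.

(** * Plane geometry *)

Section Planar.
Variable R : realType.
Implicit Types (x y z f : 'rV[R]_2) (A B : 'M[R]_2) (K L M : set 'rV[R]_2).

Lemma sum2E (V : nmodType) (F : 'I_2 -> V) : \sum_i F i = F 0 + F 1.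
Proof.
by rewrite big_ord_recl big_ord1; congr (_ + F _); exact: val_inj.
Qed.

Lemma dot2E x y : dot x y = x 0 0 * y 0 0 + x 0 1 * y 0 1.
Proof. exact: sum2E. Qed.

Lemma mul2E x A j : (x *m A) 0 j = x 0 0 * A 0 j + x 0 1 * A 1 j.
Proof. by rewrite mxE sum2E. Qed.

Lemma mulmx2E A B i j : (A *m B) i j = A i 0 * B 0 j + A i 1 * B 1 j.
Proof. by rewrite mxE sum2E. Qed.

Lemma tr2E A : \tr A = A 0 0 + A 1 1.
Proof. exact: sum2E. Qed.

Lemma det2E A : \det A = A 0 0 * A 1 1 - A 0 1 * A 1 0.
Proof.
rewrite (expand_det_row _ 0) sum2E /cofactor !det_mx11 !mxE/=.
rewrite expr0 expr1 mul1r mulN1r mulrN.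
by congr (_ * A _ _ - _ * A _ _); exact: val_inj.
Qed.

Lemma rV2P x y : x 0 0 = y 0 0 -> x 0 1 = y 0 1 -> x = y.
Proof.
move=> h0 h1; apply/rowP => i; have : (i == 0) || (i == 1).
  by case: i => -[|[|]].
by case/orP => /eqP ->.
Qed.

Lemma M2P A B : A 0 0 = B 0 0 -> A 0 1 = B 0 1 -> A 1 0 = B 1 0 ->
  A 1 1 = B 1 1 -> A = B.
Proof.
move=> h00 h01 h10 h11; apply/matrixP => i j.
have h (k : 'I_2) : (k == 0) || (k == 1) by case: k => -[|[|]].
by case/orP: (h i) => /eqP ->; case/orP: (h j) => /eqP ->.
Qed.

(** A plain real parameter replaces the bundled one of [convex_set], so that any expression may
    serve as a coefficient. *)
Definition convex_combinations M := forall x y (t : R),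
  0 <= t <= 1 -> M x -> M y -> M ((1 - t) *: x + t *: y).

Lemma convex_combinationsP M : convex_set M -> convex_combinations M.
Proof.
move=> cM x y t /andP[t0 t1] Mx My.
pose s : {i01 R} := Itv01 t0 t1.
have := cM y x s; rewrite !inE => /(_ My Mx).
by rewrite /conv/= addrC.
Qed.

Lemma convex_sum M m (b : 'I_m -> R) (p : 'I_m -> 'rV[R]_2) :
  convex_combinations M -> (forall i, 0 <= b i) -> \sum_i b i = 1 ->
  (forall i, M (p i)) -> M (\sum_i b i *: p i).
Proof.
move=> cM; elim: m b p => [|m ih] b p b0 b1 Mp.
  by move: b1 => /eqP; rewrite big_ord0 eq_sym oner_eq0.
rewrite big_ord_recl; move: b1; rewrite big_ord_recl.
set s := \sum_(i < m) _ => b1.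
have s0 : 0 <= s by apply: sumr_ge0.
have [s00|sn0] := eqVneq s 0.
  have /eqP := s00; rewrite psumr_eq0 => [/allP h|i _]; last exact: b0.
  rewrite big1 ?addr0; last first.
    by move=> i _; rewrite (eqP (h i (mem_index_enum _))) scale0r.
  have -> : b ord0 = 1 by rewrite -b1 s00 addr0.
  by rewrite scale1r.
have b0E : b ord0 = 1 - s by rewrite -b1 addrK.
pose q := \sum_(i < m) (b (lift ord0 i) / s) *: p (lift ord0 i).
have -> : \sum_(i < m) b (lift ord0 i) *: p (lift ord0 i) = s *: q.
  by rewrite scaler_sumr; apply: eq_bigr => i _; rewrite scalerA mulrCA divff// mulr1.
rewrite b0E; apply: cM => //; first by rewrite s0 -subr_ge0 -b0E b0.
apply: ih => [i||//]; first by rewrite divr_ge0.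
by rewrite -mulr_suml divff.
Qed.

Definition polar M : set 'rV[R]_2 := [set y | forall x, M x -> dot y x <= 1].

Definition box (e : R) : set 'rV[R]_2 :=
  [set x | `|x 0 0| <= e /\ `|x 0 1| <= e].

(** Testing y on the four points (e, 0), (-e, 0), (0, e), (0, -e) of M bounds its coordinates by 1 /
    e; closedness holds for any intersection of half-planes. *)
Lemma polar_compact M e : 0 < e -> box e `<=` M -> compact (polar M).
Proof.
move=> e0 eM; pose A (i : 'I_2) := `[- e^-1, e^-1]%classic.
have cA : compact [set v : 'rV[R]_2 | forall i, A i (v 0 i)].
  by apply: rV_compact => i; exact: segment_compact.
apply: (subclosed_compact _ cA).
  rewrite (_ : polar M = \bigcap_(x in M) [set y | dot y x <= 1]); last first.
    by apply/seteqP; split.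
  apply: closed_bigI => x _; rewrite (_ : mkset _ = dot x @^-1` [set t | t <= 1]).
    apply: preimage_closed; first by move=> y _; exact: dot_continuous.
    exact: closed_le.
  by apply/seteqP; split => y /=; rewrite dotC.
move=> y yM.
have b0 s : `|s| <= e -> y 0 0 * s <= 1.
  move=> se; have := yM (\row_j (if j == 0 then s else 0)).
  rewrite dot2E !mxE/= mulr0 addr0; apply; apply: eM.
  by split; rewrite mxE//= normr0 ltW.
have b1 s : `|s| <= e -> y 0 1 * s <= 1.
  move=> se; have := yM (\row_j (if j == 0 then 0 else s)).
  rewrite dot2E !mxE/= mulr0 add0r; apply; apply: eM.
  by split; rewrite mxE//= normr0 ltW.
have ee : `|e| <= e by rewrite ger0_norm// ltW.
have ne : `|- e| <= e by rewrite normrN.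
have conv (s : R) : s * e <= 1 -> s * - e <= 1 -> A 0 s.
  by move=> h1 h2; rewrite /A/= in_itv/= lerNl -[e^-1]div1r !ler_pdivlMr//; lra.
move=> i; have : (i == 0) || (i == 1) by case: i => -[|[|]].
case/orP => /eqP ->; first exact: (conv _ (b0 _ ee) (b0 _ ne)).
exact: (conv _ (b1 _ ee) (b1 _ ne)).
Qed.

(** A point outside M is strictly separated from M by some w, and a suitable negative multiple of w
    lies in the polar but exceeds 1 at that point. *)
Lemma bipolar M p : compact M -> convex_combinations M -> M 0 ->
  (forall y, polar M y -> dot y p <= 1) -> M p.
Proof.
move=> cM convM M0 hp; pose S := [set x - p | x in M].
have cS : compact S.
  apply: continuous_compact => //; apply: continuous_subspaceT => x.
  by apply: continuousB; [exact: cvg_id|exact: cst_continuous].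
have [[m [b [q [b0 b1 Sq E]]]]|[w hw]] := hull_separation cS.
  suff -> : p = \sum_i b i *: (q i + p).
    apply: convex_sum => // i; have [x Mx <-] := Sq i.
    by rewrite subrK.
  under eq_bigr do rewrite scalerDr.
  by rewrite big_split/= -E -scaler_suml b1 scale1r add0r.
have {}hw x : M x -> dot w p < dot w x.
  by move=> Mx; have := hw (x - p); rewrite dotBr subr_gt0; apply; exists x.
have [|c] := @compact_EVT_min _ _ (dot w) M _ cM
  (continuous_subspaceT (@dot_continuous _ _ w)); first by exists 0.
rewrite inE => Mc cmin.
have {}cmin x : M x -> dot w c <= dot w x by move=> Mx; apply: cmin; rewrite inE.
have := hw _ Mc; have := hw _ M0; have := cmin _ M0; rewrite dot0r => c0 p0 pc.
(* The midpoint of -w.c and -w.p: dividing -w by it gives values below 1 on M and above 1 at p. *)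
pose t := - (dot w c + dot w p) / 2.
have t0 : 0 < t by rewrite /t; lra.
have := hp (- t^-1 *: w); have E x : dot (- t^-1 *: w) x = (- dot w x) / t.
  by rewrite dotC dotZr dotC mulNr mulrC mulNr.
rewrite E ler_pdivrMr// mul1r => hpp.
suff : - dot w p <= t by rewrite /t; lra.
apply: hpp => x Mx; rewrite E ler_pdivrMr// mul1r.
by have := cmin _ Mx; rewrite /t; lra.
Qed.

End Planar.

(** * Affine maps factoring through a simplex *)

Section Factorizations.
Variable R : realType.
Implicit Types (x y : 'rV[R]_2) (A B : 'M[R]_2) (K L M : set 'rV[R]_2).

(* B is the linear part of the map x |-> sum_j b_j (1 + f_j x) z_j, whose
   coefficients are nonnegative on a symmetric L. *)
Definition factorization K L m (b : 'I_m -> R) (z f : 'I_m -> 'rV[R]_2) B :=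
  [/\ [/\ forall i, 0 <= b i, \sum_i b i = 1, forall i, K (z i)
        & forall i, polar L (f i)],
      \sum_i b i *: f i = 0 & B = \sum_i b i *: ((f i)^T *m z i)].

Definition factorizable K L : set 'M[R]_2 :=
  [set B | exists m b (z f : 'I_m -> 'rV[R]_2), @factorization K L m b z f B].

Lemma fst_coord_continuous m n i :
  continuous (fun t : 'rV[R]_m * 'rV[R]_n => t.1 0 i).
Proof.
move=> x; apply: (@cvg_comp _ _ _ fst (fun v : 'rV[R]_m => v 0 i)).
  exact: cvg_fst.
exact: rV_coord_continuous.
Qed.

Lemma snd_coord_continuous m n i :
  continuous (fun t : 'rV[R]_m * 'rV[R]_n => t.2 0 i).
Proof.
move=> x; apply: (@cvg_comp _ _ _ snd (fun v : 'rV[R]_n => v 0 i)).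
  exact: cvg_snd.
exact: rV_coord_continuous.
Qed.

Lemma tensor2E (f z : 'rV[R]_2) i j : (f^T *m z) i j = f 0 i * z 0 j.
Proof. by rewrite mxE big_ord1 mxE. Qed.

(** Keeping f next to the tensor turns the side condition sum b_j f_j = 0 into the vanishing of the
    last block of a point of a hull. *)
Definition encode (t : 'rV[R]_2 * 'rV[R]_2) : 'rV[R]_(2 * 2 + 2) :=
  row_mx (mxvec (t.1^T *m t.2)) t.1.

Lemma factorizable_hull K L B : factorizable K L B <->
  hull (encode @` (polar L `*` K)) (row_mx (mxvec B) 0).
Proof.
split=> [[m [b [z [f [[b0 b1 Kz Lf] bf ->]]]]]|[m [b [p [b0 b1 Sp E]]]]].
  exists m, b, (fun i => encode (f i, z i)); split=> //.
    by move=> i; apply: imageP; split; [exact: Lf|exact: Kz].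
  rewrite -[RHS]hsubmxK; congr row_mx; rewrite [RHS]linear_sum/=.
    by rewrite linear_sum; apply: eq_bigr => i _; rewrite !linearZ/= row_mxKl.
  by rewrite -[LHS]bf; apply: eq_bigr => i _; rewrite linearZ/= row_mxKr.
have hg i : exists t, (polar L `*` K) t /\ encode t = p i.
  by have [t ht <-] := Sp i; exists t.
pose t i := projT1 (cid (hg i)).
have ht i : (polar L `*` K) (t i) /\ encode (t i) = p i by exact: projT2 (cid (hg i)).
exists m, b, (fun i => (t i).2), (fun i => (t i).1); split.
- by split=> // i; have [[]] := ht i.
- have := congr1 rsubmx E; rewrite row_mxKr linear_sum/= => E0; rewrite [RHS]E0.
  by apply: eq_bigr => i _; rewrite linearZ/= -(ht i).2 row_mxKr.
- have := congr1 lsubmx E; rewrite row_mxKl => /(congr1 vec_mx).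
  rewrite mxvecK !linear_sum/= => ->.
  apply: eq_bigr => i _.
  by rewrite !linearZ/= -(ht i).2 row_mxKl mxvecK.
Qed.

(** Factorizable matrices are read off from the closed slice of a compact hull where the last block
    is 0. *)
Lemma factorizable_compact K L :
  compact K -> compact (polar L) -> compact (factorizable K L).
Proof.
move=> cK cL; pose S := encode @` (polar L `*` K).
have cS : compact S.
  apply: continuous_compact; last exact: compact_setX.
  apply: continuous_subspaceT; apply: rV_continuous => i.
  case: (split_ordP i) => k ->.
    case/mxvec_indexP: k => k l.
    have -> : (fun t => encode t 0 (lshift 2 (mxvec_index k l))) =
              (fun t => t.1 0 k * t.2 0 l).
      by apply/funext => t; rewrite row_mxEl mxvecE tensor2E.
    by apply: contM; [exact: fst_coord_continuous|exact: snd_coord_continuous].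
  have -> : (fun t => encode t 0 (rshift (2 * 2) k)) = (fun t => t.1 0 k).
    by apply/funext => t; rewrite row_mxEr.
  exact: fst_coord_continuous.
pose dec (v : 'rV[R]_(2 * 2 + 2)) : 'M[R]_2 := vec_mx (lsubmx v).
pose Z := [set v : 'rV[R]_(2 * 2 + 2) | rsubmx v = 0].
have cZ : closed Z.
  have -> : Z = \bigcap_(k in setT)
      ((fun v : 'rV[R]_(2 * 2 + 2) => v 0 (rshift (2 * 2) k)) @^-1` [set 0]).
    apply/seteqP; split=> v /=.
      by move=> h k _ /=; have /rowP/(_ k) := h; rewrite !mxE.
    by move=> h; apply/rowP => k; rewrite !mxE; exact: h.
  apply: closed_bigI => k _; apply: preimage_closed; last exact: closed_eq.
  by move=> v _; exact: rV_coord_continuous.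
have -> : factorizable K L = dec @` (hull S `&` Z).
  apply/seteqP; split=> [B /factorizable_hull hB|_ [v [hv vZ] <-]].
    exists (row_mx (mxvec B) 0); last by rewrite /dec row_mxKl mxvecK.
    by split=> //; rewrite /Z/= row_mxKr.
  apply/factorizable_hull; rewrite /dec vec_mxK.
  by rewrite -[X in row_mx _ X]vZ hsubmxK.
apply: continuous_compact; last first.
  by apply: compact_closedI => //; exact: hull_compact.
apply: continuous_subspaceT; apply: mx_continuous => i j.
have -> : (fun v => dec v i j) = fun v => v 0 (lshift 2 (mxvec_index i j)).
  by apply/funext => v; rewrite /dec !mxE.
exact: rV_coord_continuous.
Qed.

Lemma factorizable_convex K L A B t : 0 <= t <= 1 ->
  factorizable K L A -> factorizable K L B ->
  factorizable K L ((1 - t) *: A + t *: B).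
Proof.
move=> t01 /factorizable_hull hA /factorizable_hull hB.
apply/factorizable_hull; have := hull_convex t01 hA hB.
by rewrite !scale_row_mx add_row_mx !scaler0 addr0 linearD !linearZ.
Qed.

Definition symmetric_body L := [/\ compact L, convex_combinations L,
  (forall x, L x -> L (- x)) & exists2 e, 0 < e & box e `<=` L].

(** Here [\det A] is the signed ratio of the areas of the copy and of [L]; orientation-reversing
    copies satisfy the bound trivially. That [L] itself lies in [K] is always assumed separately. *)
Definition area_maximal K L := forall A a,
  (forall x, L x -> K (x *m A + a)) -> \det A <= 1.

(* The conclusion drawn from banach_mazur K L = 2 for L centred at 0; a ratio r
   close to 1 may be enlarged, so 1 < r loses nothing and avoids the
   homotheties without a centre. *)
Definition distance_ge2 K L := forall A a t (r : R), 0 < \det A -> 1 < r < 2 ->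
  (forall x, L x -> K (x *m A + a)) ->
  ~ (forall z, K z -> exists2 x, L x & z = r *: (x *m A) + t).

Lemma symmetric_body0 L : symmetric_body L -> L 0.
Proof. by case=> _ _ _ [e e0]; apply; split; rewrite mxE normr0 ltW. Qed.

Lemma symmetric_body_polar L : symmetric_body L -> compact (polar L).
Proof. by case=> _ _ _ [e e0 eL]; exact: polar_compact e0 eL. Qed.

Lemma polar_ge L f x : symmetric_body L -> polar L f -> L x -> -1 <= dot f x.
Proof.
by move=> [_ _ sL _] Lf Lx; rewrite lerNl -dotNr; apply/Lf/sL.
Qed.

Lemma mul_factorization K L m b z f B x :
  @factorization K L m b z f B ->
  x *m B + \sum_j b j *: z j = \sum_j (b j * (1 + dot (f j) x)) *: z j.
Proof.
move=> [_ bf ->]; rewrite mulmx_sumr -big_split; apply: eq_bigr => j _ /=.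
rewrite -scalemxAr mulmxA mulrDr mulr1 scalerDl addrC; congr (_ + _).
rewrite -scalerA; congr (_ *: _).
by apply/rowP => k; rewrite mxE big_ord1 !mxE; congr (_ * _);
  apply: eq_bigr => i _; rewrite mxE mulrC.
Qed.

Lemma sum_factorization K L m b z f B x :
  @factorization K L m b z f B -> \sum_j b j * (1 + dot (f j) x) = 1.
Proof.
move=> [[_ b1 _ _] bf _]; under eq_bigr do rewrite mulrDr mulr1.
rewrite big_split/= b1; under eq_bigr do rewrite dotC.
by rewrite -dot_sumr bf dot0r addr0.
Qed.

Lemma factorization_maps K L m b z f B x :
  convex_combinations K -> symmetric_body L ->
  @factorization K L m b z f B -> L x ->
  K (x *m B + \sum_j b j *: z j).
Proof.
move=> cK sL F Lx; rewrite (mul_factorization x F).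
have [[b0 _ Kz Lf] _ _] := F.
apply: convex_sum => // [j|]; last exact: sum_factorization F.
by rewrite mulr_ge0// -lerBlDl sub0r; exact: polar_ge Lx.
Qed.

Lemma factorizable0 K L : K !=set0 -> symmetric_body L -> factorizable K L 0.
Proof.
move=> [z Kz] sL; exists 1%N, (fun=> 1), (fun=> z), (fun=> 0).
split; rewrite ?big_ord1 ?scaler0 ?trmx0 ?mul0mx ?scaler0//.
split; rewrite ?big_ord1// => _ x Lx.
by rewrite dotC dot0r.
Qed.

End Factorizations.

(** * Copies of maximal area *)

Section Critical.
Variable R : realType.
Implicit Types (x y : 'rV[R]_2) (A B N : 'M[R]_2) (K L M : set 'rV[R]_2).

(* The polar form of 2 * \det. *)
Definition pairing A B : R := \tr A * \tr B - \tr (B *m A).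

Lemma pairingE A B : pairing A B =
  A 1 1 * B 0 0 + A 0 0 * B 1 1 - A 1 0 * B 0 1 - A 0 1 * B 1 0.
Proof. by rewrite /pairing !tr2E !mulmx2E; ring. Qed.

Lemma pairing_continuous A : continuous (pairing A).
Proof.
have -> : pairing A = fun B =>
  A 1 1 * B 0 0 + A 0 0 * B 1 1 + - (A 1 0 * B 0 1) + - (A 0 1 * B 1 0).
  by apply/funext => B; rewrite pairingE.
have c i j (a : R) : continuous (fun B : 'M[R]_2 => a * B i j).
  by apply: contM; [exact: cont_cst|exact: coord_continuous].
by apply: contD; [apply: contD; [apply: contD|apply: contN]|apply: contN].
Qed.

Lemma trace_continuous : continuous (fun B : 'M[R]_2 => \tr B).
Proof.
have -> : (fun B : 'M[R]_2 => \tr B) = fun B => B 0 0 + B 1 1.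
  by apply/funext => B; rewrite tr2E.
by apply: contD; exact: coord_continuous.
Qed.

Lemma det_continuous : continuous (fun B : 'M[R]_2 => \det B).
Proof.
have -> : (fun B : 'M[R]_2 => \det B) =
          fun B => B 0 0 * B 1 1 + - (B 0 1 * B 1 0).
  by apply/funext => B; rewrite det2E.
by apply: contD; [|apply: contN]; apply: contM; exact: coord_continuous.
Qed.

Lemma compact_max (T : topologicalType) (C : set T) (g : T -> R) :
  compact C -> C !=set0 -> continuous g ->
  exists2 c, C c & forall t, C t -> g t <= g c.
Proof.
move=> cC C0 cg; have [c] := compact_EVT_max C0 cC (continuous_subspaceT cg).
rewrite inE => Cc h; exists c => // t Ct; apply: h; by rewrite inE.
Qed.

Lemma compact_margin (T : topologicalType) (C : set T) (g : T -> R) r :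
  compact C -> continuous g -> (forall t, C t -> g t < r) ->
  exists2 s, 0 < s & forall t, C t -> g t <= r - s.
Proof.
move=> cC cg gr; have [C0|/set0P C0] := eqVneq C set0.
  by exists 1 => // t; rewrite C0.
have [t0 Ct0 t0max] := compact_max cC C0 cg.
exists (r - g t0) => [|t Ct]; first by rewrite subr_gt0; exact: gr.
by rewrite subKr; exact: t0max.
Qed.

(** The limit t -> 0 in elementary form; it extracts first-order conditions from inequalities along
    segments once a factor t has been removed. *)
Lemma affine_le0_at0 (u c : R) :
  (forall t, 0 < t <= 1 -> u + t * c <= 0) -> u <= 0.
Proof.
move=> h; rewrite leNgt; apply/negP => u0.
have [c0|c0] := leP 0 c; first by have := h 1; rewrite ltr01 lexx => /(_ isT); lra.
pose t := Order.min 1 (u / (- c) / 2).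
have t0 : 0 < t by rewrite lt_min ltr01 !divr_gt0//; lra.
have t1 : t <= 1 by rewrite ge_min lexx.
have : t * - c <= u / 2.
  rewrite -ler_pdivlMr; last lra.
  by rewrite mulrAC ge_min lexx orbT.
by have := h t; rewrite t0 t1 => /(_ isT); lra.
Qed.

(* The adjugate of A, by Cayley-Hamilton. *)
Let adj A : 'M[R]_2 := (\tr A)%:M - A.

Let adj_mul x A : x *m adj A *m A = \det A *: x.
Proof.
by apply: rV2P; rewrite !(mul2E, mxE) det2E tr2E/=; ring.
Qed.

Let pairing_tensor A (f z : 'rV[R]_2) :
  pairing A (f^T *m z) = dot f (z *m adj A).
Proof.
rewrite pairingE !tensor2E dot2E !mul2E !mxE tr2E/=; ring.
Qed.

Lemma pairing_sum A m (b : 'I_m -> R) (B : 'I_m -> 'M[R]_2) :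
  pairing A (\sum_i b i *: B i) = \sum_i b i * pairing A (B i).
Proof.
rewrite pairingE !summxE !mulr_sumr -big_split -!sumrB.
by apply: eq_bigr => i _; rewrite pairingE !mxE/=; ring.
Qed.

(** Since [pairing A B] is det A tr (A^-1 B), failure would bound this trace by some r < 2 over all
    factorizable B. Separating 0 from the points (f, f.(z adj A) - r det A) then yields a
    translation for which [bipolar] places K inside a copy of r L A, against the assumption on the
    distance. *)
Lemma distance_ge2_factorizable K L A a : symmetric_body L -> compact K ->
  K !=set0 -> distance_ge2 K L -> 0 < \det A ->
  (forall x, L x -> K (x *m A + a)) ->
  exists2 B, factorizable K L B & 2 * \det A <= pairing A B.
Proof.
move=> sL cK K0 farKL dA AK; have cL := symmetric_body_polar sL.
have [B0 DB0 B0max] := compact_max (factorizable_compact cK cL)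
  (ex_intro _ _ (factorizable0 K0 sL)) (@pairing_continuous A).
exists B0 => //; rewrite leNgt; apply/negP => lt2.
have [r r12 rmax] : exists2 r, 1 < r < 2 & pairing A B0 < r * \det A.
  pose q := pairing A B0 / \det A; have q2 : q < 2 by rewrite ltr_pdivrMr.
  (* The midpoint of q and 2 lies strictly between them; 3 / 2 keeps r above 1. *)
  exists (Order.max (3 / 2) ((q + 2) / 2)).
    by rewrite lt_max gt_max; apply/andP; split; [apply/orP; left|]; lra.
  rewrite -ltr_pdivrMr// lt_max; apply/orP; right; rewrite -/q; lra.
have r0 : 0 < r * \det A by rewrite mulr_gt0//; lra.
pose F (t : 'rV[R]_2 * 'rV[R]_2) : 'rV[R]_(2 + 1) :=
  row_mx t.1 (dot t.1 (t.2 *m adj A) - r * \det A)%:M.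
have cS : compact (F @` (polar L `*` K)).
  apply: continuous_compact; last exact: compact_setX.
  apply: continuous_subspaceT; apply: rV_continuous => i.
  case: (split_ordP i) => k ->.
    have -> : (fun t => F t 0 (lshift 1 k)) = (fun t => t.1 0 k).
      by apply/funext => t; rewrite row_mxEl.
    exact: fst_coord_continuous.
  have -> : (fun t => F t 0 (rshift 2 k)) = (fun t =>
    (\sum_i t.1 0 i * (\sum_j t.2 0 j * adj A j i)) + - (r * \det A)).
    apply/funext => t; rewrite row_mxEr mxE (ord1 k) eqxx mulr1n.
    by congr (_ - _); apply: eq_bigr => j _; rewrite mxE.
  apply: contD; last exact: cont_cst.
  apply: sum_continuous => j; apply: contM; first exact: fst_coord_continuous.
  apply: sum_continuous => l; apply: contM; first exact: snd_coord_continuous.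
  exact: cont_cst.
have [[m [b [p [b0 b1 Sp E]]]]|[w hw]] := hull_separation cS.
  have hg i : exists t, (polar L `*` K) t /\ F t = p i.
    by have [t ht <-] := Sp i; exists t.
  pose t i := projT1 (cid (hg i)).
  have ht i : (polar L `*` K) (t i) /\ F (t i) = p i by exact: projT2 (cid (hg i)).
  pose B := \sum_i b i *: ((t i).1^T *m (t i).2).
  have DB : factorizable K L B.
    exists m, b, (fun i => (t i).2), (fun i => (t i).1); split=> //.
      by split=> // i; have [[]] := ht i.
    have := congr1 lsubmx E; rewrite linear0 linear_sum/= => E0; rewrite [RHS]E0.
    by apply: eq_bigr => i _; rewrite linearZ/= -(ht i).2 row_mxKl.
  have /eqP := congr1 (fun v : 'rV_(2 + 1) => v 0 (rshift 2 0)) E.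
  rewrite mxE summxE.
  under eq_bigr do rewrite mxE -(ht _).2 row_mxEr mxE eqxx mulr1n mulrBr.
  rewrite sumrB -mulr_suml b1 mul1r eq_sym subr_eq0 => /eqP E1.
  have := B0max _ DB; rewrite pairing_sum.
  by under eq_bigr do rewrite pairing_tensor; rewrite E1; lra.
have {}hw f z : polar L f -> K z ->
    0 < dot (lsubmx w) f + w 0 (rshift 2 0) * (dot f (z *m adj A) - r * \det A).
  move=> Lf Kz; have := hw (F (f, z)) (imageP _ _).
  rewrite /dot big_split_ord/= big_ord1 row_mxEr mxE eqxx mulr1n.
  move=> /(_ (conj Lf Kz)); congr (_ < _ + _).
  by apply: eq_bigr => i _; rewrite row_mxEl mxE.
set w2 := w 0 _ in hw.
(* The functional f = 0 belongs to the polar and leaves only the term -w2 r det A, which must be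
   positive. *)
have w2lt : w2 < 0.
  have [z Kz] := K0; have := hw 0 z _ Kz; rewrite dot0r dotC dot0r add0r sub0r.
  rewrite mulrN oppr_gt0 pmulr_llt0//; apply=> x Lx.
  by rewrite dotC dot0r.
pose t' := - w2^-1 *: lsubmx w.
apply: (farKL A a ((\det A)^-1 *: (t' *m A)) r dA r12 AK) => z Kz.
exists ((r * \det A)^-1 *: (z *m adj A - t')); last first.
  rewrite -scalemxAl mulmxBl adj_mul scalerA invfM mulrA divff ?mul1r; last lra.
  by rewrite scalerBr scalerA mulVf ?scale1r ?subrK// gt_eqF.
have [cpL cvL _ _] := sL.
apply: (bipolar cpL cvL) => [|f Lf]; first exact: symmetric_body0.
rewrite dotZr mulrC ler_pdivrMr// mul1r dotBr dotZr dotC.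
have := hw f z Lf Kz; rewrite -(nmulr_llt0 _ (_ : w2^-1 < 0)) ?invr_lt0//.
rewrite mulrDl mulrAC divff ?mul1r; last by rewrite lt_eqF.
by rewrite (dotC f (_ *m _)) (dotC f (lsubmx _)); lra.
Qed.

(** All maps (1 - t) id + t B send L to K up to translation, so their determinants are at most 1: t
    = 1 bounds det B, and the derivative at t = 0 bounds tr B. *)
Lemma area_maximal_factorization K L B : symmetric_body L ->
  convex_combinations K -> L `<=` K -> area_maximal K L ->
  factorizable K L B -> \tr B <= 2 /\ \det B <= 1.
Proof.
move=> sL cK LK maxL [m [b [z [f F]]]].
have key t : 0 <= t <= 1 -> \det ((1 - t)%:M + t *: B) <= 1.
  move=> t01; apply: (maxL _ (t *: \sum_j b j *: z j)) => x Lx.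
  rewrite mulmxDr mul_mx_scalar -scalemxAr -addrA -scalerDr.
  by apply: (cK) => //; [exact: LK|exact: (factorization_maps cK sL F Lx)].
split; last first.
  by have := key 1; rewrite ler01 lexx subrr scale1r raddf0 add0r; apply.
rewrite -subr_le0.
(* The determinant at t exceeds 1 by t ((tr B - 2) + t (1 - tr B + det B)). *)
apply: (@affine_le0_at0 _ (1 - \tr B + \det B)) => t /andP[t0 t1].
have := key t; rewrite (ltW t0) t1 => /(_ isT).
rewrite !det2E tr2E !mxE/= => h.
by rewrite -(pmulr_rle0 _ t0); lra.
Qed.

End Critical.

(** * A factorizable matrix of trace 2 and determinant 1 *)

Section Rebase.
Variable R : realType.
Implicit Types (x y : 'rV[R]_2) (A B N : 'M[R]_2) (K L M : set 'rV[R]_2).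

Lemma det_segment A B t : \det ((1 - t) *: A + t *: B) =
  (1 - t) ^+ 2 * \det A + t * (1 - t) * pairing A B + t ^+ 2 * \det B.
Proof. by rewrite !det2E pairingE !mxE; ring. Qed.

Lemma pairing1 B : pairing 1%:M B = \tr B.
Proof. by rewrite pairingE tr2E !mxE/=; ring. Qed.

(** Let B maximise det among factorizable matrices of trace 2 and suppose det B = 1 - q < 1. The
    copy T = (1 - d) I + d B has det T = 1 - d^2 q, so some factorizable C satisfies (1 - d) tr C +
    d pairing B C >= 2 - 2 d^2 q. For small d this fails: if tr C is close to 2, then pairing B C is
    well below 2. *)
Lemma critical_factorization K L : symmetric_body L -> compact K ->
  convex_combinations K -> L `<=` K -> area_maximal K L -> distance_ge2 K L ->
  exists2 B, factorizable K L B & \tr B = 2 /\ \det B = 1.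
Proof.
move=> sL cK cvK LK maxL farKL.
have cL := symmetric_body_polar sL.
have K0 : K !=set0 by exists 0; exact: (LK _ (symmetric_body0 sL)).
have cD := factorizable_compact cK cL.
have bound := area_maximal_factorization sL cvK LK maxL.
have [B1 DB1 trB1] : exists2 B, factorizable K L B & \tr B = 2.
  have d1 : 0 < \det (1%:M : 'M[R]_2) by rewrite det1 ltr01.
  have LK1 x : L x -> K (x *m 1%:M + 0) by rewrite mulmx1 addr0; exact: LK.
  have [B DB] := distance_ge2_factorizable sL cK K0 farKL d1 LK1.
  rewrite det1 pairing1 => trB; exists B => //.
  by have [] := bound _ DB; lra.
pose D2 := factorizable K L `&` (fun B : 'M[R]_2 => \tr B) @^-1` [set 2].
have cD2 : compact D2.
  apply: compact_closedI => //; apply: preimage_closed; last exact: closed_eq.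
  by move=> B _; exact: trace_continuous.
have D20 : D2 !=set0 by exists B1.
have [B [DB trB] Bmax] := compact_max cD2 D20 (@det_continuous R).
exists B => //; split=> //; apply/eqP; rewrite eq_le (bound _ DB).2/=.
rewrite leNgt; apply/negP => dB; pose q := 1 - \det B.
have q0 : 0 < q by rewrite /q; lra.
(* First-order optimality of B along the segment to C gives pairing B C <= 2 det B. *)
have p2 C : factorizable K L C -> \tr C = 2 -> pairing B C <= 2 - 2 * q.
  move=> DC trC; rewrite -subr_le0.
  apply: (@affine_le0_at0 R _ (\det B - pairing B C + \det C)) => t /andP[t0 t1].
  rewrite -(pmulr_rle0 _ t0).
  have := Bmax ((1 - t) *: B + t *: C); rewrite det_segment /q => Ht.
  suff : (1 - t) ^+ 2 * \det B + t * (1 - t) * pairing B C + t ^+ 2 * \det C <=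
    \det B by lra.
  apply: Ht; split; first by apply: factorizable_convex => //; rewrite t1 ltW.
  by rewrite /= linearD !linearZ/= trB trC/=; ring.
have [C0 _ C0max] := compact_max cD (ex_intro _ _ DB) (@pairing_continuous _ B).
set Mx := pairing B C0 in C0max.
(* By [p2] no matrix with pairing at least 2 - q has trace 2, so compactness keeps these traces away
   from 2. *)
pose D3 := factorizable K L `&` pairing B @^-1` [set s | 2 - q <= s].
have cD3 : compact D3.
  apply: compact_closedI => //; apply: preimage_closed; last exact: closed_ge.
  by move=> C _; exact: pairing_continuous.
have [eta eta0 D3tr] : exists2 eta, 0 < eta & forall C, D3 C -> \tr C <= 2 - eta.
  apply: (compact_margin cD3 (@trace_continuous R)) => C [DC pC].
  rewrite lt_neqAle (bound _ DC).1 andbT; apply/eqP => /(p2 _ DC).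
  by move: pC => /=; lra.
pose c := `|Mx| + 2 * q + 1.
have c0 : 0 < c by rewrite /c; have := normr_ge0 Mx; lra.
(* The bound 1 / 2 gives 2 d^2 q <= d q for pairings below 2 - q; d c <= eta / 4 settles the
   matrices of [D3]; d c <= 1 / 4 keeps det T positive. *)
pose d := Order.min (1 / 2) (Order.min 1 eta / c / 4).
have me0 : 0 < Order.min 1 eta by rewrite lt_min ltr01.
have d0 : 0 < d by rewrite lt_min !divr_gt0.
have d2 : d <= 1 / 2 by rewrite ge_min lexx.
have : d * c <= Order.min 1 eta / 4.
  by rewrite -ler_pdivlMr// mulrAC ge_min lexx orbT.
have m1 : Order.min 1 eta <= 1 by rewrite ge_min lexx.
have m2 : Order.min 1 eta <= eta by rewrite ge_min lexx orbT.
move=> dc; have {m1}dc1 : d * c <= 1 / 4 by lra.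
have {m2 dc}dc2 : d * c <= eta / 4 by lra.
have qd : d * q <= d * c.
  by rewrite ler_pM2l// /c; have := normr_ge0 Mx; lra.
have Md : d * Mx <= d * `|Mx| by rewrite ler_pM2l// ler_norm.
have [m [b [z [f F]]]] := DB.
pose T := (1 - d) *: 1%:M + d *: B.
have dT : \det T = 1 - d * (d * q).
  by rewrite /T det_segment pairing1 trB det1 /q; ring.
have dq0 : 0 < d * q by exact: mulr_gt0.
have ddq : d * (d * q) <= 1 / 2 * (d * q).
  by rewrite ler_pM2r// mulr_gt0.
have dT0 : 0 < \det T by rewrite dT; lra.
have LKT x : L x -> K (x *m T + d *: \sum_j b j *: z j).
  move=> Lx; rewrite mulmxDr -!scalemxAr mulmx1 -addrA -scalerDr.
  apply: (cvK) => //; [by lra|exact: LK|].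
  exact: (factorization_maps cvK sL F Lx).
have [C DC] := distance_ge2_factorizable sL cK K0 farKL dT0 LKT.
have -> : pairing T C = (1 - d) * \tr C + d * pairing B C.
  by rewrite /T !pairingE tr2E !mxE/=; ring.
rewrite dT leNgt => /negP; apply.
have trC := (bound _ DC).1.
have [pC|pC] := ltP (pairing B C) (2 - q).
  have : (1 - d) * \tr C <= (1 - d) * 2 by rewrite ler_pM2l//; lra.
  have : d * pairing B C < d * (2 - q) by rewrite ltr_pM2l.
  by lra.
have : (1 - d) * \tr C <= (1 - d) * (2 - eta).
  by rewrite ler_pM2l; [exact: D3tr|lra].
have : d * pairing B C <= d * Mx by rewrite ler_pM2l//; exact: C0max.
have : d * eta <= 1 / 2 * eta by rewrite ler_pM2r.
have : d * c = d * `|Mx| + 2 * (d * q) + d by rewrite /c; ring.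
by lra.
Qed.

End Rebase.

(** * Existence of copies of maximal area and change of position *)

Section Position.
Variable R : realType.
Implicit Types (x y : 'rV[R]_2) (A B N : 'M[R]_2) (K L M : set 'rV[R]_2).

Lemma mulmx_row_continuous A : continuous (fun x => x *m A).
Proof.
apply: rV_continuous => j.
have -> : (fun x => (x *m A) 0 j) = fun x => x 0 0 * A 0 j + x 0 1 * A 1 j.
  by apply/funext => x; rewrite mul2E.
by apply: contD; apply: contM;
  [exact: rV_coord_continuous|exact: cont_cst
  |exact: rV_coord_continuous|exact: cont_cst].
Qed.

Lemma symmetric_body_image L A : symmetric_body L -> \det A != 0 ->
  symmetric_body [set x *m A | x in L].
Proof.
move=> [cL cvL sL [e e0 eL]] dA.
have uA : A \in unitmx by rewrite unitmxE unitfE.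
split.
- apply: continuous_compact => //; apply: continuous_subspaceT.
  exact: mulmx_row_continuous.
- move=> _ _ t t01 [x Lx <-] [y Ly <-]; exists ((1 - t) *: x + t *: y).
    exact: cvL.
  by rewrite mulmxDl !scalemxAl.
- by move=> _ [x Lx <-]; exists (- x); [exact: sL|rewrite mulNmx].
(* The number s exceeds the sum of the absolute values of the entries of A^-1, so A^-1 sends the box
   of size e / s into the box of size e. *)
- pose I := invmx A; pose s := `|I 0 0| + `|I 0 1| + `|I 1 0| + `|I 1 1| + 1.
  have s0 : 0 < s by rewrite ltr_wpDl// !addr_ge0.
  exists (e / s) => [|y [y0 y1]]; first exact: divr_gt0.
  exists (y *m I); last exact: mulmxKV.
  apply: eL; rewrite /box/= !mul2E.
  have b i j : `|y 0 i * I i j| <= e / s * `|I i j|.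
    rewrite normrM ler_wpM2r//.
    by have [->|->] : i = 0 \/ i = 1;
      [case: i => -[|[|]]//= ?; [left|right]; exact: val_inj| |].
  have es u v : 0 <= u -> 0 <= v -> u + v + 1 <= s -> e / s * u + e / s * v <= e.
    move=> u0 v0 uv; rewrite -mulrDr mulrAC ler_pdivrMr// ler_pM2l//.
    by lra.
  have := (normr_ge0 (I 0 0), normr_ge0 (I 0 1), normr_ge0 (I 1 0), normr_ge0 (I 1 1)).
  move=> [[[n00 n01] n10] n11].
  by split; apply: (le_trans (ler_normD _ _)); apply: (le_trans (lerD (b _ _) (b _ _)));
    apply: es => //; rewrite /s; lra.
Qed.

Lemma distance_ge2_rebase K L A0 a0 : 0 < \det A0 -> distance_ge2 K L ->
  distance_ge2 [set z | K (z + a0)] [set x *m A0 | x in L].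
Proof.
move=> dA0 far A a t r dA r12 h1 h2.
apply: (far (A0 *m A) (a + a0) (t + a0) r) => //.
- by rewrite det_mulmx mulr_gt0.
- by move=> x Lx; rewrite mulmxA addrA; apply: h1; exists x.
- move=> z Kz; have [|_ [x Lx <-] zE] := h2 (z - a0); first by rewrite /= subrK.
  by exists x => //; rewrite mulmxA addrA -zE subrK.
Qed.

Lemma area_maximal_rebase K L A0 a0 : 0 < \det A0 ->
  (forall A a, (forall x, L x -> K (x *m A + a)) -> \det A <= \det A0) ->
  area_maximal [set z | K (z + a0)] [set x *m A0 | x in L].
Proof.
move=> dA0 h A a AK.
have := h (A0 *m A) (a + a0); rewrite det_mulmx ger_pMr//; apply=> x Lx.
by rewrite mulmxA addrA; apply: AK; exists x.
Qed.

Lemma convex_body_convex K : convex_body K -> convex_combinations K.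
Proof. by case=> _ /convex_combinationsP. Qed.

Lemma convex_combinations_translate K a :
  convex_combinations K -> convex_combinations [set z | K (z + a)].
Proof.
move=> cK x y t t01 Kx Ky /=.
have -> : (1 - t) *: x + t *: y + a = (1 - t) *: (x + a) + t *: (y + a).
  by apply: rV2P; rewrite !mxE; ring.
exact: cK.
Qed.

Lemma compact_translate K a : compact K -> compact [set z | K (z + a)].
Proof.
move=> cK; have -> : [set z | K (z + a)] = [set z - a | z in K].
  apply/seteqP; split=> [z Kz|_ [z Kz <-]]; last by rewrite /= subrK.
  by exists (z + a) => //; rewrite addrK.
apply: continuous_compact => //; apply: continuous_subspaceT => x.
by apply: continuousB; [exact: cvg_id|exact: cst_continuous].
Qed.

(** An affine map is determined by the images of 0, (e, 0) and (0, e). These points of L must go to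
    K, so the admissible maps form a compact family on which det attains its maximum; a small
    homothetic copy of L near an interior point of K makes it positive. *)
Lemma maximal_position K L : convex_body K -> symmetric_body L ->
  exists A0 a0, [/\ 0 < \det A0, forall x, L x -> K (x *m A0 + a0)
    & forall A a, (forall x, L x -> K (x *m A + a)) -> \det A <= \det A0].
Proof.
move=> bK sL; have cvK := convex_body_convex bK.
have [cK _ [k]] := bK; rewrite /interior => Kk.
have [cL _ symL [e e0 eL]] := sL.
pose T := ('rV[R]_2 * ('rV[R]_2 * 'rV[R]_2))%type.
(* The linear part recovered from the three images: the difference quotients with step e. *)
pose mat (t : T) : 'M[R]_2 := \matrix_(i, j)
  (e^-1 * ((if i == 0 then t.2.1 0 j else t.2.2 0 j) - t.1 0 j)).
have c1 i : continuous (fun t : T => t.1 0 i).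
  move=> t; apply: (@cvg_comp _ _ _ fst (fun v : 'rV[R]_2 => v 0 i)).
    exact: cvg_fst.
  exact: rV_coord_continuous.
have c2 : continuous (fun t : T => t.2) by move=> t; exact: cvg_snd.
have c21 i : continuous (fun t : T => t.2.1 0 i).
  move=> t; apply: (@cvg_comp _ _ _ (fun t : T => t.2) (fun s => s.1 0 i)).
    exact: c2.
  exact: fst_coord_continuous.
have c22 i : continuous (fun t : T => t.2.2 0 i).
  move=> t; apply: (@cvg_comp _ _ _ (fun t : T => t.2) (fun s => s.2 0 i)).
    exact: c2.
  exact: snd_coord_continuous.
have cmat i j : continuous (fun t => mat t i j).
  have -> : (fun t => mat t i j) = (fun t =>
      e^-1 * ((if i == 0 then t.2.1 0 j else t.2.2 0 j) + - t.1 0 j)).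
    by apply/funext => t; rewrite mxE.
  apply: contM; first exact: cont_cst.
  by apply: contD; [case: (i == 0)|apply: contN].
pose C := (K `*` (K `*` K)) `&`
  \bigcap_(x in L) ((fun t : T => x *m mat t + t.1) @^-1` K).
have cC : compact C.
  apply: compact_closedI; first by do 2!apply: compact_setX => //.
  apply: closed_bigI => x _; apply: preimage_closed; last first.
    by apply: compact_closed => //; exact: norm_hausdorff.
  move=> t _; apply: rV_continuous => {t} j.
  have -> : (fun t : T => (x *m mat t + t.1) 0 j) = (fun t : T =>
      x 0 0 * mat t 0 j + x 0 1 * mat t 1 j + t.1 0 j).
    by apply/funext => t; rewrite mxE mul2E.
  apply: contD => //; apply: contD; apply: contM => //; exact: cont_cst.
have cdet : continuous (fun t => \det (mat t)).
  have -> : (fun t => \det (mat t)) = fun t =>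
      mat t 0 0 * mat t 1 1 + - (mat t 0 1 * mat t 1 0).
    by apply/funext => t; rewrite det2E.
  by apply: contD; [|apply: contN]; apply: contM.
have inC A a : (forall x, L x -> K (x *m A + a)) ->
    exists2 t, C t & mat t = A /\ t.1 = a.
  move=> AK; pose p i : 'rV[R]_2 := e *: row i A + a.
  have Kp i : K (p i).
    have -> : p i = (e *: delta_mx 0 i) *m A + a by rewrite -scalemxAl -rowE.
    apply/AK/eL; rewrite /box/= !mxE/=.
    by split; rewrite normrM ger0_norm ?(ltW e0)// ger_pMr// normr_nat lern1; case: eqP.
  have Ka : K a by have := AK 0 (symmetric_body0 sL); rewrite mul0mx add0r.
  have matE : mat (a, (p 0, p 1)) = A.
    have en : e != 0 by rewrite gt_eqF.
    by apply: M2P; rewrite !mxE/=; field.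
  exists (a, (p 0, p 1)) => //; split.
    by split=> //; split; exact: Kp.
  by move=> x Lx /=; rewrite matE; exact: AK.
have [A1 [a1 [dA1 A1K]]] : exists A a, 0 < \det A /\ forall x, L x -> K (x *m A + a).
  have [r r0 rK] : exists2 r, 0 < r & forall x, `|x 0 0| < r -> `|x 0 1| < r -> K (x + k).
    have /nbhs_ballP[r r0 rK] := Kk; exists r => // x x0 x1; apply: rK.
    split=> // i j; rewrite (ord1 i) /ball/= mxE opprD addrC subrK normrN.
    by case: j => -[|[|]]// h; [rewrite (_ : Ordinal h = 0)|rewrite (_ : Ordinal h = 1)];
      rewrite //; exact: val_inj.
  have [x0 Lx0 x0max] := compact_max cL (ex_intro _ _ (symmetric_body0 sL))
    (@dotvv_continuous R 2).
  (* A coordinate bound on L: the square of a coordinate is at most s, and s >= 1 gives s <= s^2. *)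
  pose s := dot x0 x0 + 1; have s1 : 1 <= s by rewrite lerDr dotvv_ge0.
  have bnd x i : L x -> `|x 0 i| <= s.
    move=> Lx; have /x0max := Lx; rewrite dot2E => h.
    have {}h : x 0 i * x 0 i <= s.
      have := (sqr_ge0 (x 0 0), sqr_ge0 (x 0 1)); rewrite /= !expr2 => -[h0 h1].
      have [->|->] : i = 0 \/ i = 1.
      - by case: i => -[|[|]]//= ?; [left|right]; exact: val_inj.
      - by rewrite /s; lra.
      - by rewrite /s; lra.
    by rewrite ler_norml; apply/andP; split; nra.
  exists (r / s / 2)%:M, k; split.
    by rewrite det_scalar exprn_gt0// !divr_gt0//; lra.
  have s0 : 0 < s by lra.
  have rs x i : L x -> `|(r / s / 2 *: x) 0 i| < r.
    move=> Lx; have := bnd x i Lx; rewrite mxE normrM gtr0_norm ?divr_gt0// => h.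
    rewrite mulrAC ltr_pdivrMr// mulrAC ltr_pdivrMr// -mulrA ltr_pM2l//.
    by lra.
  by move=> x Lx; rewrite mul_mx_scalar; apply: rK; exact: rs.
have [t1 Ct1 [mt1 _]] := inC _ _ A1K.
have [t0 Ct0 t0max] := compact_max cC (ex_intro _ _ Ct1) cdet.
exists (mat t0), t0.1; split.
- by rewrite (lt_le_trans dA1)// -mt1; exact: t0max.
- by move=> x Lx; have [_ /(_ x Lx)] := Ct0.
- by move=> A a /inC[t Ct [<- _]]; exact: t0max.
Qed.

End Position.

(** * John decompositions *)

Section John.
Variable R : realType.
Implicit Types (A B N : 'M[R]_2) (K L M : set 'rV[R]_2).

Lemma dotE n (u v : 'rV[R]_n) : dot u v = (u *m v^T) 0 0.
Proof. by rewrite mxE; apply: eq_bigr => i _; rewrite mxE. Qed.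

(** The critical B has determinant 1, so its copy of L is again of maximal area and may replace L.
    The f_j then transform by B^-1, which turns sum b_j (f_j (x) z_j) = B into the identity;
    recentring the z_j changes nothing because sum b_j f_j = 0. *)
Lemma normal_position K L : convex_body K -> symmetric_body L ->
  distance_ge2 K L ->
  exists w L' m b z f, let K' := [set x | K (x + w)] in
    [/\ symmetric_body L', L' `<=` K', area_maximal K' L'
      & @factorization R K' L' m b z f 1%:M].
Proof.
move=> bK sL far; have cvK := convex_body_convex bK; have [cK _ _] := bK.
have [A0 [a0 [dA0 A0K A0max]]] := maximal_position bK sL.
pose K1 := [set x | K (x + a0)]; pose L1 := [set x *m A0 | x in L].
have sL1 : symmetric_body L1 by apply: symmetric_body_image; rewrite // gt_eqF.
have LK1 : L1 `<=` K1 by move=> _ [x Lx <-]; exact: A0K.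
have max1 : area_maximal K1 L1 by exact: area_maximal_rebase.
have far1 : distance_ge2 K1 L1 by exact: distance_ge2_rebase.
have cK1 : compact K1 by exact: compact_translate.
have cvK1 : convex_combinations K1 by exact: convex_combinations_translate.
have [B [m [b [z [f F]]]] [trB dB]] := critical_factorization sL1 cK1 cvK1 LK1 max1 far1.
have uB : B \in unitmx by rewrite unitmxE dB unitr1.
pose w := \sum_j b j *: z j.
exists (w + a0), [set x *m B | x in L1], m, b, (fun j => z j - w),
  (fun j => f j *m (invmx B)^T) => K'.
have K'E : K' = [set x | K1 (x + w)].
  by apply/seteqP; split=> x; rewrite /K'/K1/= addrA.
have [[b0 b1 Kz Lf] bf BE] := F.
split.
- by apply: symmetric_body_image => //; rewrite dB oner_neq0.
- move=> _ [x Lx <-]; rewrite K'E.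
  exact: (factorization_maps cvK1 sL1 F Lx).
- rewrite K'E; apply: area_maximal_rebase; first by rewrite dB ltr01.
  by move=> A a; rewrite dB; exact: max1.
split.
- split=> // j; first by rewrite K'E /= subrK.
  move=> _ [x Lx <-]; have := Lf j x Lx; rewrite !dotE.
  by rewrite trmx_mul mulmxA -(mulmxA (f j)) -trmx_mul mulmxV// trmx1 mulmx1.
- under eq_bigr do rewrite scalemxAl.
  by rewrite -mulmx_suml bf mul0mx.
- transitivity (invmx B *m \sum_j b j *: ((f j)^T *m z j)).
    by rewrite -BE mulVmx.
  transitivity (\sum_j b j *: ((f j *m (invmx B)^T)^T *m z j) -
                (\sum_j b j *: (f j *m (invmx B)^T))^T *m w).
    under [X in _ - X^T *m _]eq_bigr do rewrite scalemxAl.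
    rewrite -mulmx_suml bf mul0mx trmx0 mul0mx subr0 mulmx_sumr.
    by apply: eq_bigr => j _; rewrite trmx_mul trmxK -scalemxAr mulmxA.
  rewrite [X in X *m w]raddf_sum mulmx_suml -sumrB; apply: eq_bigr => j _.
  by rewrite /= [X in X *m w]linearZ/= -scalemxAl mulmxBr scalerBr.
Qed.

Lemma dot_affine_continuous A (d : 'rV[R]_2) :
  continuous (fun t : 'rV[R]_2 * 'rV[R]_2 => dot t.2 (t.1 *m A + d)).
Proof.
have -> : (fun t : 'rV[R]_2 * 'rV[R]_2 => dot t.2 (t.1 *m A + d)) = (fun t =>
    \sum_i t.2 0 i * ((\sum_j t.1 0 j * A j i) + d 0 i)).
  by apply/funext => t; apply: eq_bigr => i _; rewrite !mxE.
apply: sum_continuous => i; apply: contM; first exact: snd_coord_continuous.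
apply: contD; last exact: cont_cst.
apply: sum_continuous => j; apply: contM; first exact: fst_coord_continuous.
exact: cont_cst.
Qed.

Lemma dot_pair_continuous :
  continuous (fun t : 'rV[R]_2 * 'rV[R]_2 => dot t.2 t.1).
Proof.
have -> : (fun t : 'rV[R]_2 * 'rV[R]_2 => dot t.2 t.1) =
    (fun t => dot t.2 (t.1 *m 1%:M + 0)).
  by apply/funext => t; rewrite mulmx1 addr0.
exact: dot_affine_continuous.
Qed.

Lemma dot_mxvec A B : dot (mxvec A) (mxvec B) = \sum_i \sum_j A i j * B i j.
Proof.
rewrite /dot (reindex _ (curry_mxvec_bij _ _)) pair_bigA.
by apply: eq_bigr => -[i j] _; rewrite /= !mxvecE.
Qed.

(** A field pointing strictly inward at all contact pairs does so with a margin, by compactness. The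
    margin pays for a small expansion, and moving L a short time along the corrected field keeps it
    in K while its area grows. *)
Lemma inward_field_not_maximal K L N (d : 'rV[R]_2) : symmetric_body L -> compact K ->
  convex_combinations K -> L `<=` K -> area_maximal K L -> \tr N = 0 ->
  ~ (forall x y, L x -> polar K y -> dot y x = 1 -> dot y (x *m N + d) < 0).
Proof.
move=> sL cK cvK LK maxL trN hN.
have K0 : K 0 by apply: LK; exact: symmetric_body0.
have cpK : compact (polar K).
  have [_ _ _ [e e0 eL]] := sL; apply: polar_compact e0 _.
  exact: subset_trans LK.
have [cL _ _ _] := sL.
have cLK : compact (L `*` polar K) by exact: compact_setX.
pose g (t : 'rV[R]_2 * 'rV[R]_2) := dot t.2 (t.1 *m N + d).
have [eta eta0 geta] : exists2 eta, 0 < eta & forall x y, L x -> polar K y ->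
    dot y x = 1 -> g (x, y) <= - eta.
  pose C := (L `*` polar K) `&` (fun t => dot t.2 t.1) @^-1` [set 1].
  have cC : compact C.
    apply: compact_closedI => //; apply: preimage_closed; last exact: closed_eq.
    by move=> t _; exact: dot_pair_continuous.
  have [|eta eta0 h] := compact_margin cC (@dot_affine_continuous N d) (r := 0).
    by move=> [x y] [[Lx Ky] xy]; exact: hN.
  exists eta => // x y Lx Ky xy; rewrite -sub0r.
  exact: (h (x, y)).
(* The trace becomes eta > 0, while the field still points inward at contacts, by at least eta /
   2. *)
pose N' := N + (eta / 2)%:M.
pose g' (t : 'rV[R]_2 * 'rV[R]_2) := dot t.2 (t.1 *m N' + d).
have g'E x y : g' (x, y) = g (x, y) + eta / 2 * dot y x.
  by rewrite /g' /g /N' mulmxDr mul_mx_scalar addrAC dotDr dotZr.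
have g'neg x y : L x -> polar K y -> dot y x = 1 -> g' (x, y) < 0.
  by move=> Lx Ky xy; have := geta x y Lx Ky xy; rewrite g'E xy; lra.
(* Pairs at which the corrected field does not point inward stay a distance s away from contact. *)
have [s s0 hs] : exists2 s, 0 < s & forall x y, L x -> polar K y ->
    0 <= g' (x, y) -> dot y x <= 1 - s.
  pose C := (L `*` polar K) `&` g' @^-1` [set r | 0 <= r].
  have cC : compact C.
    apply: compact_closedI => //; apply: preimage_closed; last exact: closed_ge.
    by move=> t _; exact: dot_affine_continuous.
  have [|s s0 h] := compact_margin cC dot_pair_continuous (r := 1).
    move=> [x y] [[Lx Ky] xy]; rewrite lt_neqAle (Ky _ (LK _ Lx)) andbT.
    by apply/eqP => yx1; have := g'neg x y Lx Ky yx1; rewrite ltNge xy.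
  exists s => // x y Lx Ky xy; exact: (h (x, y)).
have [|[x0 y0] _ Mmax] := compact_max cLK _ (@dot_affine_continuous N' d).
  exists (0, 0); split; first exact: symmetric_body0.
  by move=> x _; rewrite dotC dot0r.
set Mx := dot _ _ in Mmax.
(* The first bound keeps pairs with slack s from reaching contact; the second keeps eta + e det N'
   positive, hence the new determinant above 1. *)
pose e := Order.min (s / (`|Mx| + 1)) (eta / (`|\det N'| + 1)).
have n1 := normr_ge0 Mx; have n2 := normr_ge0 (\det N').
have e0 : 0 < e by rewrite lt_min !divr_gt0//; lra.
have eM : e * (`|Mx| + 1) <= s by rewrite -ler_pdivlMr ?ge_min ?lexx//; lra.
have ed : e * (`|\det N'| + 1) <= eta.
  by rewrite -ler_pdivlMr ?ge_min ?lexx ?orbT//; lra.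
have e1 : e * Mx <= e * `|Mx| by rewrite ler_pM2l// ler_norm.
have := maxL (1%:M + e *: N') (e *: d).
have -> : \det (1%:M + e *: N') = 1 + e * (eta + e * \det N').
  move: trN; rewrite !det2E tr2E !mxE/= => trN.
  have -> : N 1 1 = - N 0 0 by lra.
  by field.
have e2 : - (e * `|\det N'|) <= e * \det N'.
  by rewrite -mulrN ler_pM2l//; have := ler_norm (- \det N'); rewrite normrN; lra.
suff /[swap] /[apply] : forall x, L x -> K (x *m (1%:M + e *: N') + e *: d).
  by rewrite gerDl pmulr_rle0//; lra.
move=> x Lx; rewrite mulmxDr mulmx1 -scalemxAr -addrA -scalerDr.
apply: bipolar => // y Ky; rewrite dotDr dotZr -/(g' (x, y)).
have yx : dot y x <= 1 by exact/Ky/LK.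
have [h|h] := leP 0 (g' (x, y)).
  have := hs x y Lx Ky h.
  have : e * g' (x, y) <= e * Mx.
    by rewrite ler_pM2l//; apply: (Mmax (x, y)).
  by lra.
have : e * g' (x, y) < 0 by rewrite pmulr_rlt0.
by lra.
Qed.

(** If 0 is not in the hull of the encoded contact pairs, the separating functional supplies a
    traceless field pointing inward at every contact. The factor 1 / 2 is forced by traces: each y_i
    (x) x_i has trace 1. *)
Lemma inner_john K L : symmetric_body L -> compact K ->
  convex_combinations K -> L `<=` K -> area_maximal K L ->
  exists m c (x y : 'I_m -> 'rV[R]_2), [/\ [/\ forall i, 0 <= c i & \sum_i c i = 1],
    [/\ forall i, L (x i), forall i, polar K (y i) & forall i, dot (y i) (x i) = 1],
    \sum_i c i *: y i = 0 & \sum_i c i *: ((y i)^T *m x i) = (1 / 2)%:M].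
Proof.
move=> sL cK cvK LK maxL.
have cpK : compact (polar K).
  have [_ _ _ [e e0 eL]] := sL; apply: polar_compact e0 _.
  exact: subset_trans LK.
have [cL _ _ _] := sL.
pose C := (L `*` polar K) `&` (fun t => dot t.2 t.1) @^-1` [set 1].
have cC : compact C.
  apply: compact_closedI; first exact: compact_setX.
  apply: preimage_closed; last exact: closed_eq.
  by move=> t _; exact: dot_pair_continuous.
pose F (t : 'rV[R]_2 * 'rV[R]_2) : 'rV[R]_(2 * 2 + 2) :=
  row_mx (mxvec (t.2^T *m t.1 - (1 / 2)%:M)) t.2.
have cS : compact (F @` C).
  apply: continuous_compact => //.
  apply: continuous_subspaceT; apply: rV_continuous => i.
  case: (split_ordP i) => k ->.
    case/mxvec_indexP: k => k l.
    have -> : (fun t => F t 0 (lshift 2 (mxvec_index k l))) =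
              (fun t => t.2 0 k * t.1 0 l + - (1 / 2 *+ (k == l))).
      apply/funext => t; rewrite row_mxEl mxvecE mxE tensor2E; congr (_ + _).
      by rewrite !mxE.
    apply: contD; last exact: cont_cst.
    by apply: contM; [exact: snd_coord_continuous|exact: fst_coord_continuous].
  have -> : (fun t => F t 0 (rshift (2 * 2) k)) = (fun t => t.2 0 k).
    by apply/funext => t; rewrite row_mxEr.
  exact: snd_coord_continuous.
have [[m [b [p [b0 b1 Sp E]]]]|[w hw]] := hull_separation cS.
  have hg i : exists t, C t /\ F t = p i.
    by have [t ht <-] := Sp i; exists t.
  pose t i := projT1 (cid (hg i)).
  have ht i : C (t i) /\ F (t i) = p i by exact: projT2 (cid (hg i)).
  exists m, b, (fun i => (t i).1), (fun i => (t i).2); split=> //.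
  - by split=> i; have [[[]]] := ht i.
  - have := congr1 rsubmx E; rewrite linear0 linear_sum/= => E0; rewrite [RHS]E0.
    by apply: eq_bigr => i _; rewrite linearZ/= -(ht i).2 row_mxKr.
  - have := congr1 (vec_mx \o lsubmx) E; rewrite /= !linear0 !linear_sum/= => /esym.
    under eq_bigr do rewrite !linearZ/= -(ht _).2 row_mxKl mxvecK scalerBr.
    by rewrite sumrB -scaler_suml b1 scale1r => /eqP; rewrite subr_eq0 => /eqP.
exfalso.
have [W WE] : exists W : 'M[R]_2, W = vec_mx (lsubmx w) by eexists.
have [d dE] : exists d : 'rV[R]_2, d = rsubmx w by eexists.
(* The traceless part of -W^T; at a contact pair the field x N - d, paired with y, is minus the
   value of the separating functional. *)
pose N := (\tr W / 2)%:M - W^T.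
apply: (@inward_field_not_maximal K L N (- d)) => // [|x y Lx Ky yx].
  by rewrite /N !tr2E !mxE/=; field.
have Cxy : C (x, y) by [].
have := hw _ (imageP F Cxy).
have -> : dot w (F (x, y)) = dot (mxvec W) (mxvec (y^T *m x - (1 / 2)%:M)) + dot d y.
  rewrite WE vec_mxK dE /dot big_split_ord/=; congr (_ + _).
    by apply: eq_bigr => i _; rewrite row_mxEl mxE.
  by apply: eq_bigr => i _; rewrite row_mxEr mxE.
have Tij i j : (y^T *m x - (1 / 2)%:M) i j = y 0 i * x 0 j - 1 / 2 *+ (i == j).
  by rewrite mxE tensor2E !mxE.
rewrite dot_mxvec !sum2E !Tij/= => h.
have -> : N = (\tr W / 2)%:M + - W^T by [].
rewrite dotDr mulmxDr dotDr mul_mx_scalar dotZr yx mulr1 dotNr (dotC y d).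
rewrite mulmxN dotNr [dot y _]dot2E !mul2E [W^T 0 0]mxE [W^T 0 1]mxE.
by rewrite [W^T 1 0]mxE [W^T 1 1]mxE tr2E; lra.
Qed.

End John.

(** * Removing redundant contacts *)

Section JohnSystems.
Variable R : realType.
Implicit Types (A B N : 'M[R]_2) (K L M : set 'rV[R]_2).

Definition john_system K L m (c : 'I_m -> R) (x y : 'I_m -> 'rV[R]_2) :=
  [/\ [/\ forall i, 0 <= c i & \sum_i c i = 1],
    [/\ forall i, L (x i), forall i, polar K (y i) & forall i, dot (y i) (x i) = 1],
    \sum_i c i *: y i = 0 & \sum_i c i *: ((y i)^T *m x i) = (1 / 2)%:M].

Lemma john_system_drop K L m (c : 'I_m.+1 -> R) x y a :
  john_system K L c x y -> c a = 0 ->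
  exists c' x' y', @john_system K L m c' x' y'.
Proof.
move=> [[c0 c1] [Lx Ky xy] cy cxy] ca.
exists (c \o lift a), (x \o lift a), (y \o lift a); split.
- by split=> [i|]; [exact: c0|rewrite -[RHS]c1 [RHS](bigD1_ord a)//= ca add0r].
- by split=> i /=.
- by rewrite -[RHS]cy [RHS](bigD1_ord a)//= ca scale0r add0r.
- by rewrite -[RHS]cxy [RHS](bigD1_ord a)//= ca scale0r add0r.
Qed.

(** The weight of the redundant contact a is distributed over the others in proportion p, and x_i is
    averaged with x_a. These averages are still contact points, since y_i x_a = 1 whenever p_i >
    0. *)
Lemma john_system_merge K L m (c : 'I_m.+1 -> R) x y a (p : 'I_m.+1 -> R) :
  convex_combinations L -> L `<=` K ->
  john_system K L c x y -> (forall i, 0 < c i) ->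
  (forall i, 0 <= p i) -> p a = 0 -> \sum_i p i = 1 -> y a = \sum_i p i *: y i ->
  exists c' x' y', @john_system K L m c' x' y'.
Proof.
move=> cvL LK [[_ c1] [Lx Ky xy] cy cxy] c0 p0 pa p1 ya.
pose c' i := (if i == a then 0 else c i) + c a * p i.
have c'a : c' a = 0 by rewrite /c' eqxx pa mulr0 addr0.
have c'0 i : i != a -> 0 < c' i.
  by move=> /negPf ia; rewrite /c' ia ltr_wpDr// mulr_ge0// ltW.
have c'E i : i != a -> c i = c' i - c a * p i.
  by move=> /negPf ia; rewrite /c' ia addrK.
pose x' i := if i == a then x a else (1 - c a * p i / c' i) *: x i + (c a * p i / c' i) *: x a.
have tau i : i != a -> 0 <= c a * p i / c' i <= 1.
  move=> ia; have := c'0 _ ia => ci; apply/andP; split.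
    by rewrite divr_ge0 ?mulr_ge0//; exact: ltW.
  by rewrite ler_pdivrMr// mul1r -subr_ge0 -c'E// ltW.
(* The value 1 of y_a at x_a is an average of the numbers y_i x_a <= 1, so every one with positive
   weight equals 1. *)
have ya_le i : p i * dot (y i) (x a) = p i.
  have h : \sum_i p i * (1 - dot (y i) (x a)) = 0.
    under eq_bigr do rewrite mulrBr mulr1; rewrite sumrB p1.
    have : dot (x a) (y a) = 1 by rewrite dotC.
    by rewrite {1}ya dot_sumr; under eq_bigr do rewrite dotC; move=> ->; rewrite subrr.
  have h0 j : true -> 0 <= p j * (1 - dot (y j) (x a)).
    by move=> _; rewrite mulr_ge0// subr_ge0; exact/Ky/LK.
  have /eqP := h; rewrite psumr_eq0// => /allP/(_ i (mem_index_enum _))/=.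
  by rewrite mulrBr mulr1 subr_eq0 => /eqP <-.
apply: (@john_system_drop K L m c' x' y a) => //; split.
- split=> [i|]; first by case: (eqVneq i a) => [->|/c'0/ltW]; rewrite ?c'a.
  rewrite big_split/= -mulr_sumr p1 mulr1 -c1 [RHS](bigD1 a)//= addrC; congr (_ + _).
  by rewrite (bigD1 a)//= eqxx add0r; apply: eq_bigr => i /negPf ->.
- split=> // i; rewrite /x'; case: (eqVneq i a) => [E|ia]; rewrite ?E//.
    by apply: cvL => //; exact: tau.
  rewrite dotDr !dotZr xy mulr1.
  have -> : c a * p i / c' i * dot (y i) (x a) = c a * p i / c' i.
    by rewrite mulrAC -[c a * p i * dot _ _]mulrA ya_le.
  by rewrite subrK.
- rewrite -[RHS]cy (bigD1 a)//= c'a scale0r add0r [RHS](bigD1 a)//= {1}ya.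
  rewrite scaler_sumr [X in _ = X + _](bigD1 a)//= pa scale0r scaler0 add0r -big_split/=.
  apply: eq_bigr => i ia; rewrite scalerA -scalerDl; congr (_ *: _).
  by rewrite (c'E _ ia) addrC subrK.
- rewrite -[RHS]cxy (bigD1 a)//= c'a scale0r add0r [RHS](bigD1 a)//=.
  have -> : (y a)^T *m x a = \sum_(i | i != a) p i *: ((y i)^T *m x a).
    rewrite {1}ya (bigD1 a)//= pa scale0r add0r raddf_sum mulmx_suml.
    by apply: eq_bigr => i _; rewrite /= [X in X *m _]linearZ/= -scalemxAl.
  rewrite scaler_sumr -big_split/=; apply: eq_bigr => i ia.
  rewrite /x' (negPf ia) mulmxDr -!scalemxAr scalerDr !scalerA.
  have ci : c' i != 0 by rewrite gt_eqF// c'0.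
  rewrite addrC (c'E _ ia); congr (_ *: _ + _ *: _); field => //.
Qed.

(** The last clause puts the y_i in convex position; in particular they are distinct. *)
Definition reduced_john_system K L m (c : 'I_m -> R) (x y : 'I_m -> 'rV[R]_2) :=
  [/\ john_system K L c x y, forall i, 0 < c i &
    forall a (p : 'I_m -> R), (forall i, 0 <= p i) -> p a = 0 ->
      \sum_i p i = 1 -> y a <> \sum_i p i *: y i].

Lemma john_system_reduced K L m (c : 'I_m -> R) x y :
  convex_combinations L -> L `<=` K -> john_system K L c x y ->
  exists m c x y, @reduced_john_system K L m c x y.
Proof.
move=> cvL LK; elim/ltn_ind : m c x y => -[|m] ih c x y J.
  by have [[_ /eqP]] := J; rewrite big_ord0 eq_sym oner_eq0.
have [[a ca]|ca] := pselect (exists a, c a = 0).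
  by have [c' [x' [y' /ih]]] := john_system_drop J ca; exact.
have c0 i : 0 < c i.
  have [[c0 _] _ _ _] := J; rewrite lt_neqAle c0 andbT eq_sym.
  by apply/eqP => ci; apply: ca; exists i.
have [[a [p [p0 pa p1 ya]]]|h] := pselect (exists a (p : 'I_m.+1 -> R),
    [/\ forall i, 0 <= p i, p a = 0, \sum_i p i = 1 & y a = \sum_i p i *: y i]).
  by have [c' [x' [y' /ih]]] := john_system_merge cvL LK J c0 p0 pa p1 ya; exact.
exists m.+1, c, x, y; split=> // a p p0 pa p1 ya.
by apply: h; exists a, p.
Qed.

End JohnSystems.

(** * Contact lines and outer contact points *)

Section Quadrilateral.
Variable R : realType.
Implicit Types (K L : set 'rV[R]_2).

Lemma mul_tensor (u v p : 'rV[R]_2) : p *m (u^T *m v) = dot u p *: v.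
Proof. by apply: rV2P; rewrite !mul2E !tensor2E !mxE dot2E; ring. Qed.

(* Pushing the corners of the Varignon parallelogram of the quadrilateral along
   its sides, by amounts k11 * k10, k10 * k00, k00 * k01 and k01 * k11 (half
   the corresponding side being the unit), keeps it a parallelogram and
   multiplies its area by 1 + k11 * k00 * k10 * k01. *)
Lemma quadrilateral_not_maximal K L (z11 z10 z01 z00 f0 f1 : 'rV[R]_2) (k00 k01 : R) :
  convex_combinations K -> K z11 -> K z10 -> K z01 -> K z00 ->
  0 < k00 < 1 -> 0 < k01 < 1 ->
  (1 - k00) *: z11 + k00 *: z00 = (1 - k01) *: z10 + k01 *: z01 ->
  dot f0 (z11 - z00) = 4 -> dot f0 (z10 - z01) = 0 ->
  dot f1 (z11 - z00) = 0 -> dot f1 (z10 - z01) = 4 ->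
  (forall x, L x -> -1 <= dot f0 x <= 1) -> (forall x, L x -> -1 <= dot f1 x <= 1) ->
  ~ area_maximal K L.
Proof.
move=> cvK K11 K10 K01 K00 /andP[k00p k00l] /andP[k01p k01l] cross.
move=> f0U f0V f1U f1V f0L f1L maxL.
(* The crossing point of the two diagonals serves as origin. *)
pose o := (1 - k00) *: z11 + k00 *: z00.
pose U := z11 - z00; pose V := z10 - z01.
have z11E : z11 = o + k00 *: U by apply: rV2P; rewrite !mxE; ring.
have z00E : z00 = o - (1 - k00) *: U by apply: rV2P; rewrite !mxE; ring.
have z10E : z10 = o + k01 *: V by rewrite /o cross; apply: rV2P; rewrite !mxE; ring.
have z01E : z01 = o - (1 - k01) *: V.
  by rewrite /o cross; apply: rV2P; rewrite !mxE; ring.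
(* The midpoint of u and v at t = 0, and v at t = 1. *)
pose edge (t : R) u v : 'rV[R]_2 := (1 - (1 / 2 + t / 2)) *: u + (1 / 2 + t / 2) *: v.
have Kedge t u v : 0 <= t <= 1 -> K u -> K v -> K (edge t u v).
  by move=> /andP[t0 t1] Ku Kv; apply: cvK => //; lra.
have prod01 (a b : R) : 0 < a < 1 -> 0 < b < 1 -> 0 <= a * b <= 1.
  move=> /andP[a0 a1] /andP[b0 b1]; apply/andP; split.
    by rewrite mulr_ge0// ltW.
  by rewrite -[leRHS]mulr1 ler_pM// ltW.
have k11 : 0 < 1 - k00 < 1 by lra.
have k10 : 0 < 1 - k01 < 1 by lra.
have {k00p k00l}k00' : 0 < k00 < 1 by rewrite k00p.
have {k01p k01l}k01' : 0 < k01 < 1 by rewrite k01p.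
pose pa := edge ((1 - k00) * (1 - k01)) z11 z10.
pose pb := edge (k01 * (1 - k00)) z01 z11.
pose pe := edge ((1 - k01) * k00) z10 z00.
pose pd := edge (k00 * k01) z00 z01.
pose P := (1 - k00) * k00; pose Q := (1 - k01) * k01.
pose M1 : 'rV[R]_2 := (1 / 4) *: (U + Q *: V).
pose M2 : 'rV[R]_2 := (1 / 4) *: (V - P *: U).
(* L lies in the parallelogram where f0 and f1 are between -1 and 1; the map with linear part A
   carries its corners to pa, pb, pe and pd. *)
pose A : 'M[R]_2 := f0^T *m M1 + f1^T *m M2.
pose a := (1 / 4) *: (pa + pb + pe + pd).
have PQ : 0 < P * Q.
  by move: k11 k10 k00' k01' => /andP[? _] /andP[? _] /andP[? _] /andP[? _]; rewrite !mulr_gt0.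
have detA : \det A = 1 + P * Q.
  transitivity ((f0 0 0 * f1 0 1 - f0 0 1 * f1 0 0) *
     (M1 0 0 * M2 0 1 - M1 0 1 * M2 0 0)).
    by rewrite det2E /A !mxE !big_ord1 !mxE; ring.
  have -> : M1 0 0 * M2 0 1 - M1 0 1 * M2 0 0 =
      (1 + P * Q) / 16 * (U 0 0 * V 0 1 - U 0 1 * V 0 0).
    by rewrite /M1 /M2; move: (U) (V) => u v; rewrite !mxE; field.
  transitivity ((1 + P * Q) / 16 * (dot f0 U * dot f1 V - dot f0 V * dot f1 U)).
    by rewrite !dot2E; ring.
  by rewrite f0U f0V f1U f1V; field.
suff /maxL : forall x, L x -> K (x *m A + a) by rewrite detA; lra.
move=> x Lx; have /andP[s0 s1] := f0L x Lx; have /andP[t0 t1] := f1L x Lx.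
set s := dot f0 x in s0 s1; set t := dot f1 x in t0 t1.
(* Bilinear interpolation between the four moved corners. *)
have -> : x *m A + a =
    (1 - (1 - s) / 2) *: ((1 - (1 - t) / 2) *: pa + ((1 - t) / 2) *: pb) +
    ((1 - s) / 2) *: ((1 - (1 - t) / 2) *: pe + ((1 - t) / 2) *: pd).
  have -> : x *m A = s *: M1 + t *: M2.
    by rewrite mulmxDr !mul_tensor.
  rewrite /a /pa /pb /pe /pd /edge z11E z10E z01E z00E /M1 /M2 /P /Q.
  move: (o) (U) (V) (s) (t) => o' u v s' t'.
  by apply: rV2P; rewrite !mxE; field.
apply: (cvK); first lra.
  by apply: (cvK); [lra|apply: Kedge => //; exact: prod01|apply: Kedge => //; exact: prod01].
by apply: (cvK); [lra|apply: Kedge => //; exact: prod01|apply: Kedge => //; exact: prod01].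
Qed.

End Quadrilateral.

Lemma sum_enum (T : finType) (V : nmodType) (r : seq T) (F : T -> V) :
  uniq r -> size r = #|T| -> \sum_i F i = \sum_(i <- r) F i.
Proof.
move=> ur sr; rewrite [RHS]big_uniq//; apply: eq_bigl => i.
have [|_ ->] := uniq_min_size ur (fun j _ => mem_enum T j).
  by rewrite -cardE sr.
by rewrite mem_enum.
Qed.

(** * Incidences of the points [z j] with the lines [y i = 1] *)

Section Incidence.
Variable R : realType.
Variables (K L : set 'rV[R]_2) (m n : nat).
Variables (c : 'I_m -> R) (x y : 'I_m -> 'rV[R]_2).
Variables (w : 'I_n -> R) (z f : 'I_n -> 'rV[R]_2).
Hypotheses (sL : symmetric_body L) (cvK : convex_combinations K) (LK : L `<=` K).
Hypothesis J : reduced_john_system K L c x y.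
Hypothesis F : factorization K L w z f 1%:M.

Let c0 i : 0 < c i. Proof. by case: J. Qed.
Let c1 : \sum_i c i = 1. Proof. by case: J => -[[]]. Qed.
Let Lx i : L (x i). Proof. by case: J => -[_ []]. Qed.
Let Ky i : polar K (y i). Proof. by case: J => -[_ []]. Qed.
Let yx i : dot (y i) (x i) = 1. Proof. by case: J => -[_ []]. Qed.
Let cy : \sum_i c i *: y i = 0. Proof. by case: J => -[]. Qed.
Let cxy : \sum_i c i *: ((y i)^T *m x i) = (1 / 2)%:M. Proof. by case: J => -[]. Qed.
Let w0 j : 0 <= w j. Proof. by case: F => -[]. Qed.
Let w1 : \sum_j w j = 1. Proof. by case: F => -[]. Qed.
Let Kz j : K (z j). Proof. by case: F => -[]. Qed.
Let Lf j : polar L (f j). Proof. by case: F => -[]. Qed.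
Let wf : \sum_j w j *: f j = 0. Proof. by case: F. Qed.

Lemma john_identity p : \sum_i (c i * dot (y i) p) *: x i = (1 / 2) *: p.
Proof.
rewrite -mul_mx_scalar -cxy mulmx_sumr; apply: eq_bigr => i _.
by rewrite -scalemxAr mul_tensor scalerA.
Qed.

Lemma john_separates p q : (forall i, dot (y i) p = dot (y i) q) -> p = q.
Proof.
move=> h; have E : (1 / 2 : R) *: p = (1 / 2) *: q.
  by rewrite -!john_identity; apply: eq_bigr => i _; rewrite h.
by apply: (scalerI _ E); rewrite gt_eqF// divr_gt0.
Qed.

Lemma john_dual g p : \sum_i c i * dot g (x i) * dot (y i) p = dot g p / 2.
Proof.
have := congr1 (dot g) (john_identity p); rewrite dot_sumr dotZr => E.
rewrite [RHS]mulrC -div1r -E; apply: eq_bigr => i _; ring.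
Qed.

Lemma john_balanced p : \sum_i c i * dot (y i) p = 0.
Proof.
by under eq_bigr do rewrite dotC; rewrite -dot_sumr cy dot0r.
Qed.

Lemma factor_balanced p : \sum_j w j * dot (f j) p = 0.
Proof.
by under eq_bigr do rewrite dotC; rewrite -dot_sumr wf dot0r.
Qed.

Lemma fx_ge i j : 0 <= 1 + dot (f j) (x i).
Proof. by rewrite -lerBlDl sub0r; exact: (polar_ge sL (Lf j) (Lx i)). Qed.

Lemma yz_ge i j : 0 <= 1 - dot (y i) (z j).
Proof. by rewrite subr_ge0; apply: Ky; exact: Kz. Qed.

Lemma factor_identity_translated p :
  p + \sum_j w j *: z j = \sum_j (w j * (1 + dot (f j) p)) *: z j.
Proof. by rewrite -(mul_factorization p F) mulmx1. Qed.

Lemma factor_trace : \sum_j w j * dot (f j) (z j) = 2.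
Proof.
have [_ _ E] := F; have := congr1 (fun A => \tr A) E.
rewrite mxtrace1 linear_sum/= => ->; apply: eq_bigr => j _.
by rewrite linearZ/= tr2E !tensor2E dot2E.
Qed.

(* Both decompositions represent a multiple of the identity, so the products
   of the nonnegative slacks sum to zero. *)
Lemma slack i j : w j * ((1 - dot (y i) (z j)) * (1 + dot (f j) (x i))) = 0.
Proof.
have S : \sum_i c i * (\sum_j w j * ((1 - dot (y i) (z j)) * (1 + dot (f j) (x i)))) = 0.
  under eq_bigr do rewrite mulr_sumr; rewrite exchange_big/=.
  (* The sum over i of c_i y_i z_j vanishes and that of c_i f_j(x_i) y_i(z_j) is f_j(z_j) / 2.
     Summing over j leaves 1 + 0 - 2 / 2 = 0. *)
  transitivity (\sum_j w j * (1 + dot (f j) (\sum_i c i *: x i) - dot (f j) (z j) / 2)).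
    apply: eq_bigr => j' _; rewrite -john_dual dot_sumr.
    have -> : 1 + \sum_i' c i' * dot (f j') (x i') -
        \sum_i' c i' * dot (f j') (x i') * dot (y i') (z j') =
      \sum_i' c i' + \sum_i' c i' * dot (f j') (x i') -
        \sum_i' c i' * dot (f j') (x i') * dot (y i') (z j') -
        \sum_i' c i' * dot (y i') (z j').
      by rewrite c1 john_balanced subr0.
    rewrite -big_split -!sumrB mulr_sumr.
    by apply: eq_bigr => i' _ /=; ring.
  under eq_bigr do rewrite mulrBr mulrDr mulr1 mulrA.
  by rewrite sumrB big_split/= w1 factor_balanced -mulr_suml factor_trace; field.
have P i' j' : 0 <= w j' * ((1 - dot (y i') (z j')) * (1 + dot (f j') (x i'))).
  by rewrite !mulr_ge0// ?yz_ge ?fx_ge.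
have P' i' : true -> 0 <= c i' * \sum_j w j * ((1 - dot (y i') (z j)) * (1 + dot (f j) (x i'))).
  by move=> _; rewrite mulr_ge0 ?(ltW (c0 _))// sumr_ge0.
move/eqP: S; rewrite psumr_eq0// => /allP/(_ i (mem_index_enum _))/=.
rewrite mulf_eq0 gt_eqF//= psumr_eq0// => /allP/(_ j (mem_index_enum _))/=.
by move=> /eqP.
Qed.

Lemma factor_sum p : \sum_j w j * (1 + dot (f j) p) = 1.
Proof. exact: sum_factorization F. Qed.

(** The mean of the z_j is 0: at p = x_i only points on the line y_i = 1 have a nonzero coefficient,
    by [slack], so every y_i vanishes at the mean. *)
Lemma factor_identity p : p = \sum_j (w j * (1 + dot (f j) p)) *: z j.
Proof.
rewrite -factor_identity_translated; suff -> : \sum_j w j *: z j = 0 by rewrite addr0.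
apply: john_separates => i; rewrite dot0r.
have := congr1 (dot (y i)) (factor_identity_translated (x i)).
rewrite dotDr yx [RHS]dot_sumr => E.
have : \sum_j w j * (1 + dot (f j) (x i)) * dot (y i) (z j) = 1.
  rewrite -[RHS](factor_sum (x i)); apply: eq_bigr => j _.
  by have := slack i j; lra.
by move=> E1; lra.
Qed.

Definition on i j := dot (y i) (z j) == 1.

Lemma off_fx i j : 0 < w j -> ~~ on i j -> dot (f j) (x i) = -1.
Proof.
rewrite /on => wj ij; have /eqP := slack i j.
rewrite !mulf_eq0 (gt_eqF wj) subr_eq0 eq_sym (negPf ij)/= addrC addr_eq0.
by move=> /eqP.
Qed.

Lemma fx_le i j : dot (f j) (x i) <= 1.
Proof. by apply: Lf; exact: Lx. Qed.

Lemma line_identity i : \sum_(j | on i j) w j * (1 + dot (f j) (x i)) = 1.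
Proof.
rewrite -[RHS](factor_sum (x i)) [RHS](bigID (on i))/= [X in _ + X]big1 ?addr0// => j ij.
have [wj|wj] := eqVneq (w j) 0; first by rewrite wj mul0r.
by rewrite (off_fx _ ij) ?subrr ?mulr0// lt_neqAle eq_sym wj w0.
Qed.

(** The factors 1 + f_j x_i in [line_identity] are at most 2. *)
Lemma line_mass i : 1 / 2 <= \sum_(j | on i j) w j.
Proof.
rewrite ler_pdivrMr// -[leLHS](line_identity i) mulr_suml ler_sum// => j _.
by rewrite ler_wpM2l//; have := fx_le i j; lra.
Qed.

Lemma y_inj i i' : y i = y i' -> i = i'.
Proof.
move=> yy; apply/eqP; apply: contrapT => /negP ii.
have [_ _ /(_ i (fun k => (k == i')%:R))] := J; apply.
- by move=> k; rewrite ler0n.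
- by rewrite (negPf ii).
- by rewrite (bigD1 i')//= eqxx big1 ?addr0// => k /negPf ->.
- by rewrite (bigD1 i')//= eqxx scale1r big1 ?addr0// => k /negPf ->; rewrite scale0r.
Qed.

(* Three functionals equal to 1 at a common point are collinear in the dual
   plane, so one of them is a convex combination of the other two. *)
Lemma no_triple p a b d : a != b -> b != d -> a != d ->
  dot (y a) p = 1 -> dot (y b) p = 1 -> dot (y d) p = 1 -> False.
Proof.
(* A quarter turn of p: functionals equal to 1 at p are ordered by their value at q, and the middle
   one is a combination of the outer two. *)
pose q : 'rV[R]_2 := \row_i (if i == 0 then - p 0 1 else p 0 0).
have key a' b' d' : a' != b' -> b' != d' -> a' != d' ->
    dot (y a') p = 1 -> dot (y b') p = 1 -> dot (y d') p = 1 ->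
    dot (y a') q <= dot (y b') q -> dot (y b') q <= dot (y d') q -> False.
  move=> ab bd ad pa pb pd qab qbd.
  have pq u v : dot u p = 1 -> dot v p = 1 -> dot u q = dot v q -> u = v.
    rewrite !dot2E !mxE/= => h1 h2 h3.
    have pp : p 0 0 ^+ 2 + p 0 1 ^+ 2 != 0.
      apply/eqP => h; move: h1.
      have -> : p 0 0 = 0 by have := sqr_ge0 (p 0 1); nra.
      have -> : p 0 1 = 0 by have := sqr_ge0 (p 0 0); nra.
      by lra.
    apply: rV2P; apply: (mulIf pp); apply/eqP; rewrite -subr_eq0; apply/eqP.
      transitivity (
        (u 0 0 * p 0 0 + u 0 1 * p 0 1 - (v 0 0 * p 0 0 + v 0 1 * p 0 1)) * p 0 0
        - (u 0 0 * - p 0 1 + u 0 1 * p 0 0 - (v 0 0 * - p 0 1 + v 0 1 * p 0 0)) * p 0 1).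
        by ring.
      by rewrite h1 h2 h3; ring.
    transitivity (
        (u 0 0 * p 0 0 + u 0 1 * p 0 1 - (v 0 0 * p 0 0 + v 0 1 * p 0 1)) * p 0 1
        + (u 0 0 * - p 0 1 + u 0 1 * p 0 0 - (v 0 0 * - p 0 1 + v 0 1 * p 0 0)) * p 0 0).
      by ring.
    by rewrite h1 h2 h3; ring.
  have qad : dot (y a') q < dot (y d') q.
    rewrite lt_neqAle (le_trans qab qbd) andbT; apply: contraNN ad => /eqP h.
    by apply/eqP/y_inj/pq.
  pose t := (dot (y b') q - dot (y a') q) / (dot (y d') q - dot (y a') q).
  have t01 : 0 <= t <= 1.
    by rewrite divr_ge0 ?ler_pdivrMr ?subr_ge0 ?subr_gt0 ?(ltW qad)//=; lra.
  have [_ _ /(_ b' (fun k => (1 - t) * (k == a')%:R + t * (k == d')%:R))] := J; apply.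
  - by move=> k; rewrite addr_ge0// mulr_ge0 ?ler0n//; lra.
  - by rewrite (negPf bd) eq_sym (negPf ab) !mulr0 addr0.
  - rewrite big_split/= -!mulr_sumr (bigD1 a')//= eqxx big1 => [|k /negPf ->//].
    by rewrite (bigD1 d')//= eqxx big1 => [|k /negPf ->//]; rewrite !addr0 !mulr1 subrK.
  - under eq_bigr do rewrite scalerDl -(scalerA (1 - t)) -(scalerA t).
    rewrite big_split/= -!scaler_sumr.
    rewrite (bigD1 a')//= eqxx big1 => [|k /negPf ->]; last by rewrite scale0r.
    rewrite (bigD1 d')//= eqxx big1 => [|k /negPf ->]; last by rewrite scale0r.
    have dq : dot (y d') q - dot (y a') q != 0 by rewrite gt_eqF// subr_gt0.
    rewrite !addr0 !scale1r.
    have E r : dot ((1 - t) *: y a' + t *: y d') r =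
        (1 - t) * dot (y a') r + t * dot (y d') r.
      by rewrite dotC dotDr !dotZr !(dotC r).
    apply: pq => //; rewrite E; first by rewrite pa pd; ring.
    by rewrite /t; field.
move=> ab bd ad pa pb pd.
have ba : b != a by rewrite eq_sym.
have db : d != b by rewrite eq_sym.
have da : d != a by rewrite eq_sym.
case: (leP (dot (y a) q) (dot (y b) q)) => [h1|/ltW h1];
case: (leP (dot (y b) q) (dot (y d) q)) => [h2|/ltW h2];
case: (leP (dot (y a) q) (dot (y d) q)) => [h3|/ltW h3].
- exact: (key a b d).
- exact: (key a b d).
- exact: (key a d b).
- exact: (key d a b).
- exact: (key b a d).
- exact: (key b d a).
- exact: (key d b a).
- exact: (key d b a).
Qed.

Lemma on_le2 j : (#|[pred i | on i j]| <= 2)%N.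
Proof.
rewrite leqNgt; apply/negP => /card_gt2P[a [b [d [[+ + +] [ab bd da]]]]].
rewrite !inE => /eqP ha /eqP hb /eqP hd.
by apply: (no_triple ab bd _ ha hb hd); rewrite eq_sym.
Qed.

Lemma double_count : \sum_i \sum_(j | on i j) w j =
  \sum_j w j * (#|[pred i | on i j]|)%:R.
Proof.
rewrite (exchange_big_dep xpredT)//=; apply: eq_bigr => j _.
by rewrite sumr_const mulr_natr.
Qed.

(** Counting incidences by mass: every line carries at least 1 / 2, while the total mass 1 is
    counted at most twice. *)
Lemma lines_le4 : (m <= 4)%N.
Proof.
have h1 : m%:R * (1 / 2) <= \sum_i \sum_(j | on i j) w j.
  rewrite mulr_natl -[X in _ *+ X](card_ord m) -sumr_const.
  by apply: ler_sum => i _; exact: line_mass.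
have h2 : \sum_i \sum_(j | on i j) w j <= 2.
  rewrite double_count; apply: (@le_trans _ _ (\sum_j w j * 2)); last first.
    by rewrite -mulr_suml w1 mul1r.
  by apply: ler_sum => j _; rewrite ler_wpM2l// ler_nat on_le2.
rewrite -(ler_nat R); lra.
Qed.

(** With at most two functionals, sum c_i y_i = 0 makes them proportional; a vector annihilated by
    one is annihilated by all, against [john_separates]. *)
Lemma lines_ge3 : (3 <= m)%N.
Proof.
have sep := john_separates; have bal := john_balanced; have y1 := yx.
have perp (u : 'rV[R]_2) : exists2 p, dot u p = 0 & p = 0 -> u = 0.
  exists (\row_i (if i == 0 then - u 0 1 else u 0 0)).
    by rewrite dot2E !mxE/=; ring.
  move=> /rowP h; have := h 0; have := h 1; rewrite !mxE/= => h1 h0.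
  by apply: rV2P; rewrite mxE; lra.
have nz i : y i <> 0 by move=> yi; have := y1 i; rewrite yi dotC dot0r; lra.
rewrite ltnNge; apply/negP => m2.
have [i0 _] : exists i0 : 'I_m, True.
  apply: contrapT => h; have := c1; rewrite big1 => [/eqP|i _].
    by rewrite eq_sym oner_eq0.
  by exfalso; apply: h; exists i.
have yall i p : dot (y i0) p = 0 -> dot (y i) p = 0.
  move=> p0; have [->//|ii0] := eqVneq i i0.
  have := bal p; rewrite (bigD1 i0)//= p0 mulr0 add0r (bigD1 i)//= big1 ?addr0.
    by move=> /eqP; rewrite mulf_eq0 gt_eqF//= => /eqP.
  move=> k /andP[k0 ki]; exfalso; move: m2; rewrite leqNgt => /negP; apply.
  rewrite -[X in (_ < X)%N]card_ord; apply/card_gt2P; exists i0, i, k.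
  by split; split=> //; rewrite eq_sym.
have [p yp pu] := perp (y i0).
apply: (nz i0); apply: pu; apply: sep => i; rewrite dot0r.
exact: yall.
Qed.

(** * Three contact lines *)

Lemma sum_three (V : nmodType) (G : 'I_m -> V) a b d : m = 3%N ->
  a != b -> b != d -> a != d -> \sum_i G i = G a + G b + G d.
Proof.
move=> m3 ab bd ad; rewrite (@sum_enum _ _ [:: a; b; d]).
- by rewrite !big_cons big_nil addr0 addrA.
- by rewrite /= !inE negb_or ab bd ad.
- by rewrite [RHS]card_ord ; exact: esym.
Qed.

Lemma third_index (a b : 'I_m) : m = 3%N -> exists d, d != a /\ d != b.
Proof.
move=> m3; apply: contrapT => /forallNP h.
have : (#|'I_m| <= #|[:: a; b]|)%N.
  apply: subset_leq_card; apply/fintype.subsetP => d _; rewrite !inE.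
  by apply/negP => /negP; rewrite negb_or => /andP[da db]; apply: (h d).
by move=> /leq_trans/(_ (card_size _)); rewrite card_ord /= m3.
Qed.

Let s := \sum_i c i *: x i.

(** For three lines, the intersection of the two lines other than a; the closed formula comes from
    applying [john_identity] to that point. *)
Definition vertex a : 'rV[R]_2 := 2 *: (s - x a).

(** Let v be the intersection of lines b and d. In the sum of c_i (1 - y_i v), which is 1, and in
    that of c_i (1 - y_i v) x_i, which is s - v / 2, only the term a survives; hence s - v / 2 =
    x_a. *)
Lemma vertexP a b d : m = 3%N -> a != b -> b != d -> a != d ->
  dot (y b) (vertex a) = 1 /\ c a * (1 - dot (y a) (vertex a)) = 1.
Proof.
move=> m3 ab bd ad.
have [v [yb yd]] : exists v, dot (y b) v = 1 /\ dot (y d) v = 1.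
  pose D := y b 0 0 * y d 0 1 - y b 0 1 * y d 0 0.
  have D0 : D != 0.
    apply/eqP => D0; pose p : 'rV[R]_2 := \row_i (if i == 0 then - y b 0 1 else y b 0 0).
    have pb : dot (y b) p = 0 by rewrite dot2E !mxE/=; ring.
    have pd : dot (y d) p = 0 by rewrite dot2E !mxE/= -[RHS]D0 /D; ring.
    have pa : dot (y a) p = 0.
      have := john_balanced p; rewrite (sum_three _ m3 ab bd ad) pb pd !mulr0 !addr0.
      by move=> /eqP; rewrite mulf_eq0 gt_eqF//= => /eqP.
    have /rowP p0 : p = 0.
      apply: john_separates => i; rewrite dot0r.
      have := sum_three (fun j => if j == i then dot (y j) p else 0) m3 ab bd ad.
      by rewrite -big_mkcond big_pred1_eq pa pb pd !if_same !addr0.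
    have := yx b; have := p0 0; have := p0 1; rewrite !mxE/= dot2E => -> /eqP.
    by rewrite oppr_eq0 => /eqP ->; rewrite !mul0r addr0; lra.
  exists (\row_i (if i == 0 then (y d 0 1 - y b 0 1) / D else (y b 0 0 - y d 0 0) / D)).
  by rewrite !dot2E !mxE/= /D; split; field.
have ca : c a * (1 - dot (y a) v) = 1.
  have := sum_three (fun i => c i * (1 - dot (y i) v)) m3 ab bd ad.
  rewrite yb yd subrr !mulr0 !addr0 => <-.
  by under eq_bigr do rewrite mulrBr mulr1; rewrite sumrB c1 john_balanced subr0.
suff -> : vertex a = v by [].
have : s - (1 / 2) *: v = x a.
  rewrite -john_identity -sumrB.
  under eq_bigr do rewrite -scalerBl -{1}[c _]mulr1 -mulrBr.
  by rewrite (sum_three _ m3 ab bd ad) yb yd subrr !mulr0 !scale0r !addr0 ca scale1r.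
move=> E; rewrite /vertex -E subKr scalerA.
by rewrite (_ : 2 * (1 / 2) = 1) ?scale1r//; field.
Qed.

Lemma vertex_on a b : m = 3%N -> a != b -> dot (y b) (vertex a) = 1.
Proof.
move=> m3 ab; have [d [da db]] := third_index a b m3.
have bd : b != d by rewrite eq_sym.
have ad : a != d by rewrite eq_sym.
by have [] := vertexP m3 ab bd ad.
Qed.

Lemma vertex_off a : m = 3%N -> c a * (1 - dot (y a) (vertex a)) = 1.
Proof.
move=> m3; have [b [ba _]] := third_index a a m3.
have [d [da db]] := third_index a b m3.
have ab : a != b by rewrite eq_sym.
have bd : b != d by rewrite eq_sym.
have ad : a != d by rewrite eq_sym.
by have [] := vertexP m3 ab bd ad.
Qed.

Lemma vertex_off_lt a : m = 3%N -> dot (y a) (vertex a) < 1.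
Proof.
move=> m3; rewrite -subr_gt0 -(pmulr_rgt0 _ (c0 a)) vertex_off//.
Qed.

(** The difference x_b - x_a is half of vertex a minus vertex b, and y_a is smaller at vertex a than
    at vertex b. *)
Lemma touching_off a b : m = 3%N -> a != b -> dot (y a) (x b) < 1.
Proof.
move=> m3 ab; have E i : x i = s - (1 / 2) *: vertex i.
  by rewrite /vertex scalerA (_ : 1 / 2 * 2 = 1) ?scale1r ?subKr//; field.
have -> : x b = x a + ((1 / 2) *: vertex a - (1 / 2) *: vertex b).
  by rewrite (E a) (E b) addrA subrK.
have ba : b != a by rewrite eq_sym.
rewrite dotDr dotBr (dotZr _ _ (vertex a)) (dotZr _ _ (vertex b)) yx (vertex_on m3 ba).
by have := vertex_off_lt a m3; lra.
Qed.

(* If no z_j is the vertex opposite to line a, then some z_j lies on line b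
   only; its functional is y_b, which forces y_b = -1 at the contact x_a. *)
Lemma opposite_contact a b d : m = 3%N -> a != b -> b != d -> a != d ->
  (forall j, z j <> vertex a) -> dot (y b) (x a) = -1.
Proof.
move=> m3 ab bd ad nz.
have s3 := fun V G => @sum_three V G a b d m3 ab bd ad.
have zv j : on b j -> on d j -> False.
  move=> /eqP hb /eqP hd; apply: (nz j); apply: john_separates => i.
  have vb := vertex_on m3 ab; have vd := vertex_on m3 ad.
  have h : c a * dot (y a) (z j) = c a * dot (y a) (vertex a).
    have := john_balanced (z j); have := john_balanced (vertex a).
    by rewrite !s3 hb hd vb vd; lra.
  have {}h : dot (y a) (z j) = dot (y a) (vertex a) by apply: (mulfI _ h); rewrite gt_eqF.
  have := s3 R (fun k => if k == i then dot (y k) (z j) - dot (y k) (vertex a) else 0).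
  rewrite -big_mkcond big_pred1_eq h hb hd vb vd !subrr !if_same !addr0 => /eqP.
  by rewrite subr_eq0 => /eqP.
(* Otherwise every active point on line b would lie on line a, and [factor_identity] at x_b would
   put x_b on line a. *)
have [j [wj jb ja]] : exists j, [/\ 0 < w j, on b j & ~~ on a j].
  apply: contrapT => /forallNP h.
  suff : dot (y a) (x b) = 1 by have := touching_off m3 ab; lra.
  have := congr1 (dot (y a)) (factor_identity (x b)); rewrite dot_sumr => ->.
  rewrite -[RHS](factor_sum (x b)); apply: eq_bigr => j _.
  have [wj|wj] := eqVneq (w j) 0; first by rewrite wj !mul0r.
  have wj0 : 0 < w j by rewrite lt_neqAle eq_sym wj w0.
  case: (boolP (on b j)) => jb; last by rewrite (off_fx wj0 jb) subrr mulr0 mul0r.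
  case: (boolP (on a j)) => [/eqP ->|ja]; first by rewrite mulr1.
  by exfalso; apply: (h j).
have jd : ~~ on d j by apply/negP => jd; exact: (zv j).
have fa := off_fx wj ja; have fd := off_fx wj jd.
(* As f_j is -1 at x_a and x_d, [john_dual] and the balance condition make it the multiple k of y_b.
   Then k <= 1, k y_b(x_a) = -1 and y_b(x_a) >= -1 force k = 1. *)
pose k := 2 * c b * (1 + dot (f j) (x b)).
have fE p : dot (f j) p = k * dot (y b) p.
  have := john_dual (f j) p; have := john_balanced p.
  by rewrite !s3 fa fd /k; lra.
have k0 : 0 <= k by rewrite /k !mulr_ge0 ?fx_ge// ltW.
have k1 : k <= 1 by have := fE (x b); rewrite yx mulr1 => <-; exact: fx_le.
have kE : k * dot (y b) (x a) = -1 by rewrite -fE.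
have yb : -1 <= dot (y b) (x a).
  have [_ _ sym _] := sL; rewrite lerNl -dotNr; apply: Ky.
  by apply/LK/sym; exact: Lx.
have : k * (dot (y b) (x a) + 1) >= 0 by rewrite mulr_ge0//; lra.
rewrite mulrDr kE mulr1 => k1'; have kk : k = 1 by lra.
by move: kE; rewrite kk mul1r.
Qed.

(** If the vertex is not among the z_j, then y_b and y_d are both -1 at x_a. So the vertex is -x_a,
    a point of L. *)
Lemma vertex_in a : m = 3%N -> K (vertex a).
Proof.
move=> m3; apply: contrapT => nK.
have nz j : z j <> vertex a by move=> zj; apply: nK; rewrite -zj; exact: Kz.
have [b [ba _]] := third_index a a m3.
have [d [da db]] := third_index a b m3.
have ab : a != b by rewrite eq_sym.
have ad : a != d by rewrite eq_sym.
have bd : b != d by rewrite eq_sym.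
have yb := opposite_contact m3 ab bd ad nz.
have yd := opposite_contact m3 ad db ab nz.
suff xv : vertex a = - x a.
  have [_ _ sym _] := sL.
  by apply: nK; rewrite xv; apply/LK/sym; exact: Lx.
apply: john_separates => i; rewrite dotNr.
have vb := vertex_on m3 ab; have vd := vertex_on m3 ad.
have s3 := fun V G => @sum_three V G a b d m3 ab bd ad.
have h : c a * dot (y a) (vertex a) = c a * - dot (y a) (x a).
  have := john_balanced (x a); have := john_balanced (vertex a).
  by rewrite !s3 vb vd yb yd; lra.
have {}h : dot (y a) (vertex a) = - dot (y a) (x a) by apply: (mulfI _ h); rewrite gt_eqF.
have := s3 R (fun k => if k == i then dot (y k) (vertex a) + dot (y k) (x a) else 0).
rewrite -big_mkcond big_pred1_eq h yb yd vb vd !subrr addNr !if_same !addr0 => /eqP.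
by rewrite addr_eq0 => /eqP.
Qed.

(** The numbers c_i (1 - y_i p) are the barycentric coordinates of p; they are nonnegative on K,
    which places K in the triangle. *)
Lemma vertex_combination p : m = 3%N ->
  \sum_i (c i * (1 - dot (y i) p)) *: vertex i = p.
Proof.
move=> m3; apply: john_separates => k; rewrite dot_sumr.
rewrite (bigD1 k)//= (eq_bigr (fun i => c i * (1 - dot (y i) p))); last first.
  by move=> i ik; rewrite (vertex_on m3 ik) mulr1.
have t1 : \sum_i c i * (1 - dot (y i) p) = 1.
  by under eq_bigr do rewrite mulrBr mulr1; rewrite sumrB c1 john_balanced subr0.
have := vertex_off k m3; set v := dot _ (vertex k) => cv.
have -> : \sum_(i | i != k) c i * (1 - dot (y i) p) = 1 - c k * (1 - dot (y k) p).
  by have := t1; rewrite (bigD1 k)//=; lra.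
have -> : c k * (1 - dot (y k) p) * v = c k * (1 - dot (y k) p) - (c k * (1 - v)) * (1 - dot (y k) p).
  by ring.
by rewrite cv; ring.
Qed.

Lemma three_lines_triangle : m = 3%N -> exists v1 v2 v3, [/\ K v1, K v2, K v3,
  (v2 - v1) 0 0 * (v3 - v1) 0 1 - (v2 - v1) 0 1 * (v3 - v1) 0 0 != 0 &
  forall p, K p -> exists t1 t2 t3, [/\ 0 <= t1, 0 <= t2, 0 <= t3,
    t1 + t2 + t3 = 1 & p = t1 *: v1 + t2 *: v2 + t3 *: v3]].
Proof.
move=> m3; have [a _] : exists a : 'I_m, True.
  have m0 : (0 < m)%N by rewrite m3.
  by exists (Ordinal m0).
have [b [ba _]] := third_index a a m3.
have [d [da db]] := third_index a b m3.
have ab : a != b by rewrite eq_sym.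
have ad : a != d by rewrite eq_sym.
have bd : b != d by rewrite eq_sym.
exists (vertex a), (vertex b), (vertex d); split; try exact: vertex_in.
  have hab := vertex_on m3 ab; have had := vertex_on m3 ad.
  have hbd := vertex_on m3 bd; have hdb := vertex_on m3 db.
  have hb := vertex_off_lt b m3; have hd := vertex_off_lt d m3.
  apply/eqP => D0.
  (* On the two edges from vertex a, y_b and y_d form a diagonal matrix with nonzero entries; its
     determinant has that of the edges as a factor. *)
  have : dot (y b) (vertex b - vertex a) * dot (y d) (vertex d - vertex a) -
      dot (y b) (vertex d - vertex a) * dot (y d) (vertex b - vertex a) = 0.
    move: D0; set u := vertex b - _; set v := vertex d - _ => D0.
    rewrite !dot2E.
    transitivity ((y b 0 0 * y d 0 1 - y b 0 1 * y d 0 0) * (u 0 0 * v 0 1 - u 0 1 * v 0 0)).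
      by ring.
    by rewrite D0 mulr0.
  rewrite !dotBr hab had hbd hdb !subrr mulr0 subr0; apply/eqP.
  by rewrite mulf_neq0// lt_eqF// subr_lt0.
move=> p Kp; pose t i := c i * (1 - dot (y i) p).
have t0 i : 0 <= t i.
  by rewrite mulr_ge0 ?(ltW (c0 i))// subr_ge0; apply: Ky.
exists (t a), (t b), (t d); split=> //.
  rewrite -(sum_three t m3 ab bd ad) /t.
  by under eq_bigr do rewrite mulrBr mulr1; rewrite sumrB c1 john_balanced subr0.
by rewrite -(sum_three (fun i => t i *: vertex i) m3 ab bd ad) vertex_combination.
Qed.

(** * Four contact lines *)

Ltac drop_context := clear -R K L m n c x y w z f sL cvK LK J F
  c0 c1 Lx Ky yx cy cxy w0 w1 Kz Lf wf s.

Lemma sum_four (V : nmodType) (G : 'I_m -> V) a b e d : m = 4%N ->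
  uniq [:: a; b; e; d] -> \sum_i G i = G a + G b + G e + G d.
Proof.
move=> m4 u; rewrite (@sum_enum _ _ [:: a; b; e; d])//.
  by rewrite !big_cons big_nil addr0 !addrA.
by rewrite [RHS]card_ord; exact: esym.
Qed.

(** For four lines both estimates in the double count give 2, so both are equalities. *)
Lemma incidence_tight : m = 4%N ->
  (forall i, \sum_(j | on i j) w j = 1 / 2) /\
  (forall j, 0 < w j -> (#|[pred i | on i j]|)%:R = 2 :> R).
Proof.
move=> m4; pose S1 := \sum_i (\sum_(j | on i j) w j - 1 / 2).
pose S2 := \sum_j w j * (2 - (#|[pred i | on i j]|)%:R).
have S10 : 0 <= S1.
  by apply: sumr_ge0 => i _; rewrite subr_ge0; exact: line_mass.
have h2 j : 0 <= w j * (2 - (#|[pred i | on i j]|)%:R).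
  by rewrite mulr_ge0// subr_ge0 ler_nat on_le2.
have S20 : 0 <= S2 by apply: sumr_ge0 => j _.
have S12 : S1 + S2 = 0.
  have m2 : (1 / 2 : R) *+ m = 2 by rewrite m4 -mulr_natr; lra.
  rewrite /S1 sumrB double_count sumr_const card_ord m2.
  rewrite /S2; under [X in _ + X]eq_bigr do rewrite mulrBr.
  rewrite sumrB -mulr_suml w1; lra.
split=> [i|j wj].
  have /eqP : S1 = 0 by lra.
  rewrite psumr_eq0 => [/allP/(_ i (mem_index_enum _))/=|i' _].
    by rewrite subr_eq0 => /eqP.
  by rewrite subr_ge0; exact: line_mass.
have /eqP : S2 = 0 by lra.
rewrite psumr_eq0// => /allP/(_ j (mem_index_enum _))/=.
by rewrite mulf_eq0 gt_eqF//= subr_eq0 => /eqP.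
Qed.

(** A line mass of exactly 1 / 2 leaves no room in [line_mass]: each factor 1 + f_j x_i of positive
    weight is 2. *)
Lemma on_fx i j : m = 4%N -> 0 < w j -> on i j -> dot (f j) (x i) = 1.
Proof.
move=> m4 wj ij; have [mass _] := incidence_tight m4.
have : \sum_(k | on i k) w k * (1 - dot (f k) (x i)) = 0.
  have := line_identity i; have := mass i.
  have -> : \sum_(k | on i k) w k * (1 + dot (f k) (x i)) =
      \sum_(k | on i k) (2 * w k - w k * (1 - dot (f k) (x i))).
    by apply: eq_bigr => k _; ring.
  by rewrite sumrB -mulr_sumr => ->; lra.
move/eqP; rewrite psumr_eq0 => [/allP/(_ j (mem_index_enum _))/=|k _].
  by rewrite ij /= mulf_eq0 gt_eqF//= subr_eq0 => /eqP.
by rewrite mulr_ge0// subr_ge0; exact: fx_le.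
Qed.

(** If p and q are independent, their values determine a functional and y_a = y_b; if they are
    dependent, the common value 1 makes them equal. *)
Lemma two_lines a b p q : a != b -> dot (y a) p = 1 -> dot (y b) p = 1 ->
  dot (y a) q = 1 -> dot (y b) q = 1 -> p = q.
Proof.
move=> ab; rewrite !dot2E => ap bp aq bq.
have [D0|D0] := eqVneq (p 0 0 * q 0 1 - p 0 1 * q 0 0) 0.
  apply: rV2P; apply/eqP; rewrite -subr_eq0; apply/eqP.
    transitivity (p 0 0 * (y a 0 0 * q 0 0 + y a 0 1 * q 0 1) -
                  q 0 0 * (y a 0 0 * p 0 0 + y a 0 1 * p 0 1)).
      by rewrite aq ap !mulr1.
    transitivity (y a 0 1 * (p 0 0 * q 0 1 - p 0 1 * q 0 0)); first by ring.
    by rewrite D0 mulr0.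
  transitivity (p 0 1 * (y a 0 0 * q 0 0 + y a 0 1 * q 0 1) -
                q 0 1 * (y a 0 0 * p 0 0 + y a 0 1 * p 0 1)).
    by rewrite aq ap !mulr1.
  transitivity (- y a 0 0 * (p 0 0 * q 0 1 - p 0 1 * q 0 0)); first by ring.
  by rewrite D0 mulr0.
case/eqP: ab; apply: y_inj; apply: rV2P; apply: (mulIf D0); apply/eqP;
  rewrite -subr_eq0; apply/eqP.
  transitivity (((y a 0 0 * p 0 0 + y a 0 1 * p 0 1) -
                 (y b 0 0 * p 0 0 + y b 0 1 * p 0 1)) * q 0 1 -
                ((y a 0 0 * q 0 0 + y a 0 1 * q 0 1) -
                 (y b 0 0 * q 0 0 + y b 0 1 * q 0 1)) * p 0 1); first by ring.
  by rewrite ap bp aq bq; ring.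
transitivity (((y a 0 0 * q 0 0 + y a 0 1 * q 0 1) -
               (y b 0 0 * q 0 0 + y b 0 1 * q 0 1)) * p 0 0 -
              ((y a 0 0 * p 0 0 + y a 0 1 * p 0 1) -
               (y b 0 0 * p 0 0 + y b 0 1 * p 0 1)) * q 0 0); first by ring.
by rewrite ap bp aq bq; ring.
Qed.

Lemma on_excludes a b e j : a != b -> b != e -> a != e ->
  on a j -> on b j -> ~~ on e j.
Proof.
move=> ab be ae /eqP ja /eqP jb; apply/negP => /eqP je.
exact: (no_triple ab be ae ja jb je).
Qed.

(** The lines form opposite pairs a, d and b, e, and every active z_j lies on one line of each pair.
    So the z_j are the four corners of a quadrilateral, the f_j are f0, f1 and their negatives, and
    [quadrilateral_not_maximal] applies. *)
Lemma four_lines_crossing a b e d j0 j1 : m = 4%N -> uniq [:: a; b; e; d] ->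
  0 < w j0 -> 0 < w j1 -> on a j0 -> on b j0 -> on a j1 -> on e j1 ->
  ~ area_maximal K L.
Proof.
move=> m4 u w_j0 w_j1 a0 b0 a1 e1.
have s4 := fun V G => @sum_four V G a b e d m4 u.
have [mass _] := incidence_tight m4.
have [[ab ae ad] [be bd ed]] : [/\ a != b, a != e & a != d] /\ [/\ b != e, b != d & e != d].
  move: u; rewrite /= !inE !negb_or !andbT => /and3P[/and3P[? ? ?] /andP[? ?] ?].
  by do 2!split.
have eb : e != b by rewrite eq_sym.
have e0 : ~~ on e j0 := on_excludes ab be ae a0 b0.
have d0 : ~~ on d j0 := on_excludes ab bd ad a0 b0.
have b1 : ~~ on b j1 := on_excludes ae eb ab a1 e1.
have d1 : ~~ on d j1 := on_excludes ae ed ad a1 e1.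
pose f0 := f j0; pose f1 := f j1.
have f0a : dot f0 (x a) = 1 := on_fx m4 w_j0 a0.
have f0b : dot f0 (x b) = 1 := on_fx m4 w_j0 b0.
have f0e : dot f0 (x e) = -1 := off_fx w_j0 e0.
have f0d : dot f0 (x d) = -1 := off_fx w_j0 d0.
have f1a : dot f1 (x a) = 1 := on_fx m4 w_j1 a1.
have f1b : dot f1 (x b) = -1 := off_fx w_j1 b1.
have f1e : dot f1 (x e) = 1 := on_fx m4 w_j1 e1.
have f1d : dot f1 (x d) = -1 := off_fx w_j1 d1.
have sep p q : dot f0 p = dot f0 q -> dot f1 p = dot f1 q -> p = q.
  have D : (f0 0 0 * f1 0 1 - f0 0 1 * f1 0 0) != 0.
    apply/eqP => D0; suff : dot f0 (x a) * dot f1 (x b) - dot f0 (x b) * dot f1 (x a) = 0.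
      by rewrite f0a f0b f1a f1b; lra.
    rewrite !dot2E.
    transitivity ((f0 0 0 * f1 0 1 - f0 0 1 * f1 0 0) *
                  (x a 0 0 * x b 0 1 - x a 0 1 * x b 0 0)); first by ring.
    by rewrite D0 mul0r.
  rewrite !dot2E => h0 h1; apply: rV2P; apply: (mulIf D); apply/eqP;
    rewrite -subr_eq0; apply/eqP.
    transitivity (((f0 0 0 * p 0 0 + f0 0 1 * p 0 1) - (f0 0 0 * q 0 0 + f0 0 1 * q 0 1)) * f1 0 1
      - ((f1 0 0 * p 0 0 + f1 0 1 * p 0 1) - (f1 0 0 * q 0 0 + f1 0 1 * q 0 1)) * f0 0 1).
      by ring.
    by rewrite h0 h1; ring.
  transitivity (((f1 0 0 * p 0 0 + f1 0 1 * p 0 1) - (f1 0 0 * q 0 0 + f1 0 1 * q 0 1)) * f0 0 0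
      - ((f0 0 0 * p 0 0 + f0 0 1 * p 0 1) - (f0 0 0 * q 0 0 + f0 0 1 * q 0 1)) * f1 0 0).
    by ring.
  by rewrite h0 h1; ring.
have xd : x d = - x a by apply: sep; rewrite dotNr ?f0d ?f0a ?f1d ?f1a.
have xe : x e = - x b by apply: sep; rewrite dotNr ?f0e ?f0b ?f1e ?f1b ?opprK.
have span p : p = ((dot f0 p + dot f1 p) / 2) *: x a + ((dot f0 p - dot f1 p) / 2) *: x b.
  by apply: sep; rewrite dotDr !dotZr ?f0a ?f0b ?f1a ?f1b; field.
have fxd j : dot (f j) (x d) = - dot (f j) (x a) by rewrite xd dotNr.
have fxe j : dot (f j) (x e) = - dot (f j) (x b) by rewrite xe dotNr.
have ond j : 0 < w j -> on d j = ~~ on a j.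
  move=> wj; have := fxd j; case: (boolP (on a j)) => ja; case: (boolP (on d j)) => jd //.
    by rewrite (on_fx m4 wj ja) (on_fx m4 wj jd); drop_context; lra.
  by rewrite (off_fx wj ja) (off_fx wj jd); drop_context; lra.
have one j : 0 < w j -> on e j = ~~ on b j.
  move=> wj; have := fxe j; case: (boolP (on b j)) => jb; case: (boolP (on e j)) => je //.
    by rewrite (on_fx m4 wj jb) (on_fx m4 wj je); drop_context; lra.
  by rewrite (off_fx wj jb) (off_fx wj je); drop_context; lra.
have fE j p : dot (f j) p = (dot f0 p + dot f1 p) / 2 * dot (f j) (x a) +
    (dot f0 p - dot f1 p) / 2 * dot (f j) (x b).
  by rewrite {1}(span p) dotDr !dotZr.
(* Masses at the four corners; the digits record incidence with a and with b. *)
pose B11 := \sum_(j | on a j && on b j) w j.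
pose B10 := \sum_(j | on a j && ~~ on b j) w j.
pose B01 := \sum_(j | ~~ on a j && on b j) w j.
pose B00 := \sum_(j | ~~ on a j && ~~ on b j) w j.
have m1 : B11 + B10 = 1 / 2 by rewrite -(mass a) [RHS](bigID (on b)).
have m2 : B11 + B01 = 1 / 2.
  rewrite -(mass b) [RHS](bigID (on a))/=; congr (_ + _); apply: eq_bigl => j;
    exact: andbC.
have m3 : B01 + B00 = 1 / 2.
  have : \sum_(j | on a j) w j + \sum_(j | ~~ on a j) w j = 1.
    by rewrite -[RHS]w1 [RHS](bigID (on a)).
  rewrite (mass a) [X in _ + X](bigID (on b))/= -/B01 -/B00; lra.
have pos (Q : pred 'I_n) j : Q j -> 0 < w j -> 0 < \sum_(k | Q k) w k.
  by move=> Qj wj; rewrite (bigD1 j)//= ltr_wpDr// sumr_ge0.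
have ex (Q : pred 'I_n) : 0 < \sum_(k | Q k) w k -> exists2 j, Q j & 0 < w j.
  move=> Q0; apply: contrapT => h; move: Q0; rewrite big1 ?ltxx// => j Qj.
  apply/eqP; rewrite eq_le w0 andbT leNgt; apply/negP => wj.
  by apply: h; exists j.
have B11p : 0 < B11 by apply: (pos _ j0) => //; rewrite a0.
have B10p : 0 < B10 by apply: (pos _ j1) => //; rewrite a1.
have [j2 /andP[a2 b2] w_j2] : exists2 j, ~~ on a j && on b j & 0 < w j.
  by apply: ex; rewrite -/B01; move: m1 m2 B10p; drop_context; lra.
have [j3 /andP[a3 b3] w_j3] : exists2 j, ~~ on a j && ~~ on b j & 0 < w j.
  by apply: ex; rewrite -/B00; move: m2 m3 B11p; drop_context; lra.
have d2 : on d j2 by rewrite ond.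
have d3 : on d j3 by rewrite ond.
have e3 : on e j3 by rewrite one.
have e2 : ~~ on e j2 by rewrite one// b2.
have cls (Q : pred 'I_n) (t : R) p z' :
    (forall j, Q j -> 0 < w j -> dot (f j) p = t /\ z j = z') ->
    \sum_(j | Q j) (w j * (1 + dot (f j) p)) *: z j = ((\sum_(j | Q j) w j) * (1 + t)) *: z'.
  move=> h; rewrite mulr_suml scaler_suml; apply: eq_bigr => j Qj.
  have [wj|wj] := eqVneq (w j) 0; first by rewrite wj !mul0r !scale0r.
  by have [|-> ->] := h j Qj; first by rewrite lt_neqAle eq_sym wj w0.
have E2 i j : on i j -> dot (y i) (z j) = 1 by move=> /eqP.
(* [factor_identity] grouped by corners: within a class the z_j coincide, and the f_j are f0, f1,
   -f1 and -f0 respectively. *)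
have rep p : p = (B11 * (1 + dot f0 p)) *: z j0 + (B10 * (1 + dot f1 p)) *: z j1 +
    ((B01 * (1 - dot f1 p)) *: z j2 + (B00 * (1 - dot f0 p)) *: z j3).
  rewrite {1}(factor_identity p) (bigID (on a))/=; congr (_ + _).
    rewrite (bigID (on b))/=; congr (_ + _); apply: cls => j /andP[ja jb] wj; split.
    - by rewrite fE (on_fx m4 wj ja) (on_fx m4 wj jb); field.
    - by apply: (two_lines ab); exact: E2.
    - by rewrite fE (on_fx m4 wj ja) (off_fx wj jb); field.
    - by apply: (two_lines ae); apply: E2 => //; rewrite one.
  rewrite (bigID (on b))/=; congr (_ + _); apply: cls => j /andP[ja jb] wj; split.
  - by rewrite fE (off_fx wj ja) (on_fx m4 wj jb); field.
  - by apply: (two_lines bd); apply: E2 => //; rewrite ond.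
  - by rewrite fE (off_fx wj ja) (off_fx wj jb); field.
  - by apply: (two_lines ed); apply: E2 => //; rewrite ?one ?ond.
have lin g p : dot g p = B11 * dot f0 p * (dot g (z j0) - dot g (z j3)) +
    B10 * dot f1 p * (dot g (z j1) - dot g (z j2)).
  have := congr1 (dot g) (rep 0); have := congr1 (dot g) (rep p).
  rewrite !dotDr !dotZr !dot0r.
  have -> : B01 = B10 by move: m1 m2; drop_context; lra.
  have -> : B00 = B11 by move: m2 m3; drop_context; lra.
  by move=> h1 h2; rewrite h1; move: h2; drop_context; lra.
have c4 : c a + c b + c e + c d = 1 by rewrite -s4.
have f0E p : dot f0 p = 4 * (c a * dot (y a) p + c b * dot (y b) p).
  have := john_dual f0 p; have := john_balanced p.
  by rewrite !s4 f0a f0b f0e f0d; drop_context; lra.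
have f0E' p : dot f0 p = - (4 * (c e * dot (y e) p + c d * dot (y d) p)).
  have := john_dual f0 p; have := john_balanced p.
  by rewrite !s4 f0a f0b f0e f0d; drop_context; lra.
have f1E p : dot f1 p = 4 * (c a * dot (y a) p + c e * dot (y e) p).
  have := john_dual f1 p; have := john_balanced p.
  by rewrite !s4 f1a f1b f1e f1d; drop_context; lra.
have f1E' p : dot f1 p = - (4 * (c b * dot (y b) p + c d * dot (y d) p)).
  have := john_dual f1 p; have := john_balanced p.
  by rewrite !s4 f1a f1b f1e f1d; drop_context; lra.
have f0z0 := f0E (z j0); rewrite (E2 _ _ a0) (E2 _ _ b0) !mulr1 in f0z0.
have f0z3 := f0E' (z j3); rewrite (E2 _ _ e3) (E2 _ _ d3) !mulr1 in f0z3.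
have f1z1 := f1E (z j1); rewrite (E2 _ _ a1) (E2 _ _ e1) !mulr1 in f1z1.
have f1z2 := f1E' (z j2); rewrite (E2 _ _ b2) (E2 _ _ d2) !mulr1 in f1z2.
have f0U : dot f0 (z j0) - dot f0 (z j3) = 4 by rewrite f0z0 f0z3; move: c4; drop_context; lra.
have f1V : dot f1 (z j1) - dot f1 (z j2) = 4 by rewrite f1z1 f1z2; move: c4; drop_context; lra.
(* At x_a and x_b the functional f0 is 1 while f1 is 1 and -1; comparing the two equations shows
   that f0 agrees at z_j1 and z_j2. *)
have la := lin f0 (x a); have lb := lin f0 (x b).
rewrite f0a f1a f0U !mulr1 in la; rewrite f0b f1b f0U !mulr1 in lb.
have f0V : dot f0 (z j1) - dot f0 (z j2) = 0.
  have h : B10 * (dot f0 (z j1) - dot f0 (z j2)) = 0 by move: la lb; drop_context; lra.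
  by move/eqP: h; rewrite mulf_eq0 gt_eqF//= => /eqP.
have B11E : B11 = 1 / 4 by rewrite f0V in la; move: la; drop_context; lra.
have f1U : dot f1 (z j0) - dot f1 (z j3) = 0.
  by have := lin f1 (x a); rewrite f0a f1a f1V B11E; move: B11E m1; drop_context; lra.
have offlt i j : 0 < w j -> ~~ on i j -> 0 < c i * (1 - dot (y i) (z j)).
  move=> wj ij; rewrite mulr_gt0// lt_neqAle yz_ge andbT eq_sym subr_eq0 eq_sym.
  exact: ij.
(* The weighted slacks of a point add up to 1 and two of them vanish, so these come in pairs of sum
   1; [k00] and [k01] are the ratios in which the diagonals cross. *)
pose k00 := c b * (1 - dot (y b) (z j1)); pose k11 := c d * (1 - dot (y d) (z j1)).
pose k01 := c e * (1 - dot (y e) (z j0)); pose k10 := c d * (1 - dot (y d) (z j0)).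
have k00p : 0 < k00 by exact: offlt.
have k11p : 0 < k11 by exact: offlt.
have k01p : 0 < k01 by exact: offlt.
have k10p : 0 < k10 by exact: offlt.
have f0z1 := f0E (z j1); have f0z1' := f0E' (z j1).
rewrite (E2 _ _ a1) !mulr1 in f0z1; rewrite (E2 _ _ e1) !mulr1 in f0z1'.
have f1z0 := f1E (z j0); have f1z0' := f1E' (z j0).
rewrite (E2 _ _ a0) !mulr1 in f1z0; rewrite (E2 _ _ b0) !mulr1 in f1z0'.
have k1 : k00 + k11 = 1 by rewrite /k00 /k11; move: f0z1 f0z1' c4; drop_context; lra.
have k2 : k01 + k10 = 1 by rewrite /k01 /k10; move: f1z0 f1z0' c4; drop_context; lra.
have bnd j p : L p -> -1 <= dot (f j) p <= 1.
  by move=> Lp; rewrite (polar_ge sL (Lf j) Lp)/=; exact: Lf.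
apply: (@quadrilateral_not_maximal R K L (z j0) (z j1) (z j2) (z j3) f0 f1 k00 k01) => //.
- by move: k00p k11p k1; drop_context; move=> *; apply/andP; split; lra.
- by move: k01p k10p k2; drop_context; move=> *; apply/andP; split; lra.
- apply: sep; rewrite !dotDr !dotZr.
    have -> : dot f0 (z j2) = dot f0 (z j1) by move: f0V; drop_context; lra.
    have -> : dot f0 (z j3) = dot f0 (z j0) - 4 by move: f0U; drop_context; lra.
    by rewrite f0z0 f0z1 /k00; drop_context; lra.
  have -> : dot f1 (z j3) = dot f1 (z j0) by move: f1U; drop_context; lra.
  have -> : dot f1 (z j2) = dot f1 (z j1) - 4 by move: f1V; drop_context; lra.
  by rewrite f1z1 f1z0 /k01; drop_context; lra.
- by rewrite dotBr.
- by rewrite dotBr.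
- by rewrite dotBr.
- by rewrite dotBr.
- exact: bnd.
- exact: bnd.
Qed.

(** Let a, b be the two lines through an active point. Some other active point lies on just one of
    them, and relabelling reduces to [four_lines_crossing]. *)
Lemma four_lines_not_maximal : m = 4%N -> ~ area_maximal K L.
Proof.
move=> m4 maxL; have [_ two] := incidence_tight m4.
have [j0 w_j0] : exists j, 0 < w j.
  apply: contrapT => /forallNP h; have := w1; rewrite big1 => [/eqP|j _].
    by rewrite eq_sym oner_eq0.
  by apply/eqP; rewrite eq_le w0 andbT leNgt; apply/negP/h.
pose P := [pred i | on i j0].
have sP : size (enum P) = 2%N.
  by apply/eqP; rewrite -cardE -(eqr_nat R) two.
have sP' : size (enum (predC P)) = 2%N.
  by apply/eqP; rewrite -cardE -(eqn_add2l #|P|) cardC card_ord cardE sP m4.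
have [a [b Pab]] : exists a b, enum P = [:: a; b].
  by case: (enum P) sP => [|a [|b [|? ?]]]// _; exists a, b.
have [e [d Ped]] : exists e d, enum (predC P) = [:: e; d].
  by case: (enum (predC P)) sP' => [|e [|d [|? ?]]]// _; exists e, d.
have u : uniq [:: a; b; e; d].
  rewrite -[[:: a; b; e; d]]/([:: a; b] ++ [:: e; d]) -Pab -Ped cat_uniq !enum_uniq/= andbT.
  by apply/hasPn => i; rewrite !mem_enum.
have a0 : on a j0 by have := mem_enum P a; rewrite Pab !inE eqxx.
have b0 : on b j0 by have := mem_enum P b; rewrite Pab !inE eqxx orbT.
have s4 := fun V G => @sum_four V G a b e d m4 u.
have count j : 0 < w j -> (on a j + on b j + on e j + on d j)%N = 2%N.
  move=> wj; apply/eqP; rewrite -(eqr_nat R) -(two j wj) -sum1_card.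
  rewrite natr_sum big_mkcond/= s4 !inE !natrD.
  by case: (on a j); case: (on b j); case: (on e j); case: (on d j).
have [j1 w_j1 ab1] : exists2 j, 0 < w j & on a j != on b j.
  apply: contrapT => h.
  (* If no such point exists, all contact points are x_a or -x_a. The functional g orthogonal to x_a
     then vanishes by [john_dual], contradicting y_a(x_a) = 1. *)
  have same j : 0 < w j -> dot (f j) (x a) = dot (f j) (x b) /\
      dot (f j) (x e) = dot (f j) (x d) /\ dot (f j) (x e) = - dot (f j) (x a).
    move=> wj; have := count j wj.
    have : on a j = on b j by have [//|ab] := eqVneq (on a j) (on b j); exfalso; apply: h; exists j.
    case: (boolP (on a j)) => ja; case: (boolP (on b j)) => jb //= _;
    case: (boolP (on e j)) => je; case: (boolP (on d j)) => jd //= _;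
    rewrite ?(on_fx m4 wj ja) ?(on_fx m4 wj jb) ?(on_fx m4 wj je) ?(on_fx m4 wj jd);
    by rewrite ?(off_fx wj ja) ?(off_fx wj jb) ?(off_fx wj je) ?(off_fx wj jd) ?opprK.
  have ext p q : (forall j, 0 < w j -> dot (f j) p = dot (f j) q) -> p = q.
    move=> pq; rewrite (factor_identity p) (factor_identity q).
    apply: eq_bigr => j _; have [wj|wj] := eqVneq (w j) 0; first by rewrite wj !mul0r.
    by rewrite pq// lt_neqAle eq_sym wj w0.
  have xab : x b = x a by apply: ext => j /same[].
  have xe : x e = - x a by apply: ext => j /same[_ [_]]; rewrite dotNr.
  have xd : x d = - x a by rewrite -xe; apply: ext => j /same[_ []].
  pose g : 'rV[R]_2 := \row_i (if i == 0 then - x a 0 1 else x a 0 0).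
  have ga : dot g (x a) = 0 by rewrite dot2E !mxE/=; ring.
  have g0 p : dot g p = 0.
    have := john_dual g p; rewrite s4 xab xe xd !dotNr ga !(oppr0, mulr0, mul0r) !addr0.
    by lra.
  have := yx a; have := g0 g; rewrite dotC => /dotvv_eq0 /rowP gz.
  have := gz 0; have := gz 1; rewrite !mxE/= dot2E => -> /eqP.
  by rewrite oppr_eq0 => /eqP ->; rewrite !(mulr0, mul0r) addr0; lra.
have ed1 : on e j1 != on d j1.
  by move: ab1 (count j1 w_j1); case: (on a j1); case: (on b j1); case: (on e j1);
    case: (on d j1).
have perm u' : perm_eq u' [:: a; b; e; d] -> uniq u' by move=> /perm_uniq ->.
have [a1|a1] := boolP (on a j1); have [e1|e1] := boolP (on e j1).
- exact: (four_lines_crossing m4 u w_j0 w_j1 a0 b0 a1 e1 maxL).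
- have d1 : on d j1 by move: ed1; rewrite (negPf e1); case: (on d j1).
  have u' : uniq [:: a; b; d; e].
    by apply: perm; rewrite !perm_cons; apply/permP => Q /=; rewrite !addn0 addnC.
  exact: (four_lines_crossing m4 u' w_j0 w_j1 a0 b0 a1 d1 maxL).
- have b1 : on b j1 by move: ab1; rewrite (negPf a1); case: (on b j1).
  have u' : uniq [:: b; a; e; d].
    by apply: perm; apply/permP => Q /=; rewrite addnCA.
  exact: (four_lines_crossing m4 u' w_j0 w_j1 b0 a0 b1 e1 maxL).
- have b1 : on b j1 by move: ab1; rewrite (negPf a1); case: (on b j1).
  have d1 : on d j1 by move: ed1; rewrite (negPf e1); case: (on d j1).
  have u' : uniq [:: b; a; d; e].
    apply: perm; apply/permP => Q /=; rewrite addnCA; congr (_ + (_ + _))%N.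
    by rewrite !addn0 addnC.
  exact: (four_lines_crossing m4 u' w_j0 w_j1 b0 a0 b1 d1 maxL).
Qed.

End Incidence.

(** * From the Banach-Mazur distance to the triangle *)

Section Assembly.
Variable R : realType.
Implicit Types (K L : set 'rV[R]_2).

Lemma symmetric_body_center L c : convex_body L ->
  (forall x, L x -> L (c *+ 2 - x)) -> symmetric_body [set x | L (x + c)].
Proof.
move=> bL symL; have [cL _ [k]] := bL; rewrite /interior => /nbhs_ballP[r r0 rL].
have cvL := convex_body_convex bL.
have sL x : L (x + c) -> L (- x + c).
  by move=> /symL; rewrite mulr2n opprD addrACA subrr addr0 addrC.
split; [exact: compact_translate|exact: convex_combinations_translate|exact: sL|].
have r4 : 0 < r / 4 by rewrite divr_gt0.
exists (r / 4) => // x [x0 x1] /=.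
(* The midpoint of a point near k and the reflection of k in c; the doubling of x is why r / 4
   suffices. *)
have -> : x + c = (1 - 1 / 2) *: (k + 2 *: x) + (1 / 2) *: (- (k - c) + c).
  by apply: rV2P; rewrite !mxE; field.
apply: cvL => //; first lra.
  apply: rL; split=> // i j; rewrite (ord1 i) /ball/= mxE opprD addNKr normrN mxE.
  rewrite normrM ger0_norm//.
  case: j => -[|[|]]// h.
    rewrite (_ : Ordinal h = 0); last exact: val_inj.
    by move: x0 r0 => /=; lra.
  rewrite (_ : Ordinal h = 1); last exact: val_inj.
  by move: x1 r0 => /=; lra.
apply: sL; rewrite subrK; apply: rL; split=> // i j; exact: ballxx.
Qed.

(** Two inclusions of ratio r < 2 with unrelated translations give an admissible r in the infimum
    once the origin is suitably moved. *)
Lemma banach_mazur_distance_ge2 K L c : banach_mazur K L = 2 ->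
  distance_ge2 K [set x | L (x + c)].
Proof.
move=> dKL A a t r dA /andP[r1 r2] inK outK.
have r0 : 0 < r by lra.
suff : banach_mazur K L <= r by rewrite dKL; lra.
apply: ge_inf; first by exists 0 => s [/ltW].
have uA : A \in unitmx by rewrite unitmxE unitfE gt_eqF.
have uB : r *: A \in unitmx by rewrite unitmxZ// unitfE gt_eqF.
pose T : {linear 'rV[R]_2 -> 'rV[R]_2} := mulmxr (r *: A).
(* The solution of t + u = r (a + u), available because r > 1; it makes the outer body the dilate of
   the translated K about 0. *)
pose u := (r - 1)^-1 *: (t - r *: a).
pose v := (t + u) *m invmx (r *: A) - c.
have Tv x : T (x + c + v) = r *: (x *m A) + t + u.
  rewrite /T/= /v addrACA subrr addr0 mulmxDl mulmxKV// -scalemxAr addrA//.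
split=> //; exists T, u, v; split.
- exists (fun x => x *m invmx (r *: A)) => x; rewrite /T/=.
    by rewrite mulmxK.
  by rewrite mulmxKV.
- move=> _ [z Kz <-]; have [x Lx ->] := outK z Kz.
  exists (x + c + v); last exact: Tv.
  by exists (x + c).
- move=> _ [_ [l Ll <-] <-]; exists ((l - c) *m A + a + u).
    by exists ((l - c) *m A + a) => //; apply: inK; rewrite /= subrK.
  have -> : l + v = (l - c) + c + v by rewrite subrK.
  rewrite Tv !scalerDr -!addrA; congr (_ + _).
  have r1' : r - 1 != 0 by rewrite gt_eqF// subr_gt0.
  by rewrite /u; apply: rV2P; rewrite !mxE; field.
Qed.

Lemma is_triangle_of_combinations K (v1 v2 v3 : 'rV[R]_2) :
  convex_set K -> K v1 -> K v2 -> K v3 ->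
  (v2 - v1) 0 0 * (v3 - v1) 0 1 - (v2 - v1) 0 1 * (v3 - v1) 0 0 != 0 ->
  (forall p, K p -> exists t1 t2 t3, [/\ 0 <= t1, 0 <= t2, 0 <= t3,
    t1 + t2 + t3 = 1 & p = t1 *: v1 + t2 *: v2 + t3 *: v3]) ->
  is_triangle K.
Proof.
move=> cK K1 K2 K3 D comb; exists v1, v2, v3; split.
  rewrite free_cons seq1_free span_seq1; apply/andP; split.
    apply/negP => /vlineP[k E]; move: D; rewrite E !mxE => /eqP; apply; ring.
  by apply/eqP => E; move: D; rewrite E !mxE => /eqP; apply; ring.
apply/seteqP; split=> [p /comb[t1 [t2 [t3 [t10 t20 t30 t123 ->]]]] C [cC sC]|].
  have := @convex_sum R C 3 (fun i => [:: t1; t2; t3]`_i)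
    (fun i => [:: v1; v2; v3]`_i) (convex_combinationsP cC).
  rewrite !big_ord_recl !big_ord0 /= !addr0 !addrA; apply => //.
  - by case=> -[|[|[|]]].
  - by case=> -[|[|[|]]]//= _; apply: sC; [left; left|left; right|right].
apply: smallest_sub => //.
by move=> _ [[->|->]|->].
Qed.

End Assembly.

Theorem theorem1 (R : realType) (K L : set 'rV[R]_2)
  (hK : convex_body K) (hL : convex_body L)
  (symL : centrally_symmetric L)
  (dKL : banach_mazur K L = 2) :
  is_triangle K.
Proof.
have [c sc] := symL; have [cK cvK _] := hK.
have sL0 := symmetric_body_center hL sc.
have far : distance_ge2 K [set x | L (x + c)].
  exact: banach_mazur_distance_ge2 dKL.
have [a [L' [n [b [z [f [sL' LK' maxL F]]]]]]] := normal_position hK sL0 far.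
set K' := [set x | K (x + a)] in LK' maxL F.
have cK' : compact K' by exact: compact_translate.
have cvK' : convex_combinations K'.
  exact: convex_combinations_translate (convex_body_convex hK).
have [m0 [c0 [x0 [y0 J0]]]] := inner_john sL' cK' cvK' LK' maxL.
have [_ cvL' _ _] := sL'.
have [m [w [x [y J]]]] := john_system_reduced cvL' LK' J0.
have m3 := lines_ge3 J; have m4 := lines_le4 sL' J F.
have [mE|mE] : m = 3%N \/ m = 4%N.
  by move: m3 m4; case: (m) => [|[|[|[|[|]]]]]//; [left|right].
  have [v1 [v2 [v3 [K1 K2 K3 D comb]]]] := three_lines_triangle sL' LK' J F mE.
  apply: (is_triangle_of_combinations cvK K1 K2 K3).
    have E u v : u + a - (v + a) = u - v by rewrite opprD addrACA subrr addr0.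
    by rewrite !E.
  move=> p Kp; have [|t1 [t2 [t3 [h1 h2 h3 h123 E]]]] := comb (p - a).
    by rewrite /K'/= subrK.
  exists t1, t2, t3; split=> //.
  (* Weights of sum 1 commute with the translation by a. *)
  rewrite -[LHS](subrK a) E; have -> : t3 = 1 - t1 - t2 by rewrite -h123; ring.
  by apply: rV2P; rewrite !mxE; ring.
by have := four_lines_not_maximal sL' cvK' J F mE maxL.
Qed.
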